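(* Let $Q$ be an $n$-element poset of width $2$. If $Q\in\mathcal{Q}$, then there exists a constant $C$, depending only on $Q$, such that $\mathrm{FF}(w,Q)\le 2^{C(\lg w)^2}$ for every positive integer $w$; in fact $C=O(n)$ suffices, i.e. there is an absolute constant $K$ (independent of $Q$, $n$ and $w$) such that one may take $C\le Kn$. If $Q\notin\mathcal{Q}$, then $\mathrm{FF}(w,Q)\ge 2^w-1$ for every positive integer $w$.
   Context: All posets are finite. The width of a poset is the size of a maximum antichain. A poset $Q$ is a subposet of $P$ if (a poset isomorphic to) $Q$ can be obtained from $P$ by deleting elements, i.e. $Q$ is isomorphic to an induced suborder of $P$; $P$ is $Q$-free if $Q$ is not a subposet of $P$. $\lg$ is the base-2 logarithm. First-Fit: the elements of a poset $P$ are processed one at a time in a given presentation order. If $\{x_1,\ldots,x_{k-1}\}$ has already been partitioned into chains $(C_1,\ldots,C_t)$, then $x_k$ is added to the first chain $C_j$ such that $C_j\cup\{x_k\}$ is a chain; if there is no such $j$, a new chain $C_{t+1}=\{x_k\}$ is introduced. $\mathrm{FF}(w,Q)$ is the maximum, over all $Q$-free posets $P$ of width $w$ and all presentation orders of $P$, of the number of chains that First-Fit uses (with value $\infty$ if unbounded, and $0$ if there is no such $P$). A poset is ladder-like if its elements can be partitioned into two chains $C_1$ and $C_2$ (one of which may be empty) such that if $(x,y)\in C_1\times C_2$ and $x$ is comparable to $y$, then $x<y$. The series composition of posets $S_1,\ldots,S_n$ is the poset consisting of disjoint copies of $S_1,\ldots,S_n$, each with its own order, arranged so that $x<y$ whenever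 $x\in S_i$, $y\in S_j$ and $i<j$. $\mathcal{Q}$ is the minimal family of posets (closed under isomorphism) that contains the ladder-like posets and is closed under series composition. *)

(* Defs.v *)
From mathcomp Require Import all_boot all_order all_algebra.
From mathcomp Require Import all_classical all_reals all_analysis.

Set Implicit Arguments.
Unset Strict Implicit.
Unset Printing Implicit Defensive.

Import Order.TTheory GRing.Theory Num.Theory.

Local Open Scope order_scope.

Definition is_chain (d : Order.disp_t) (P : finPOrderType d) (A : {set P}) : bool :=
  [forall x in A, forall y in A, x >=< y].

Definition is_antichain (d : Order.disp_t) (P : finPOrderType d) (A : {set P}) : bool :=
  [forall x in A, forall y in A, (x >=< y) ==> (x == y)].

Definition width (d : Order.disp_t) (P : finPOrderType d) : nat :=
  (\max_(A : {set P} | is_antichain A) #|A|)%N.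

Definition poset_iso (d d' : Order.disp_t) (P : finPOrderType d)
    (P' : finPOrderType d') : Prop :=
  exists2 f : P -> P', bijective f & {mono f : x y / x <= y}.

(* By antisymmetry such an [f] is injective, so it is an isomorphism from [Q]
   onto the suborder of [P] induced on its image. *)
Definition subposet (d d' : Order.disp_t) (Q : finPOrderType d)
    (P : finPOrderType d') : Prop :=
  exists f : Q -> P, {mono f : x y / x <= y}.

Definition poset_free (d d' : Order.disp_t) (Q : finPOrderType d)
    (P : finPOrderType d') : Prop :=
  ~ subposet Q P.

Definition ladder_like (d : Order.disp_t) (P : finPOrderType d) : Prop :=
  exists C1 C2 : {set P},
    [/\ C1 :|: C2 = [set: P]%SET, [disjoint C1 & C2], is_chain C1, is_chain C2
      & forall x y : P, x \in C1 -> y \in C2 -> x >=< y -> x < y].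

(* The library orders a sigma type lexicographically; with the index type 'I_n,
   this puts all of [S i] below all of [S j] when [i < j]. *)
Definition series_comp (d : Order.disp_t) (n : nat) (S : 'I_n -> finPOrderType d) :
    finPOrderType d :=
  Order.FinPOrder.clone d {i : 'I_n & S i} _.

(* That the [S i] share a display is no restriction, since [series_ladder_iso]
   may change it. *)
Inductive series_ladder : forall d : Order.disp_t, finPOrderType d -> Prop :=
| series_ladder_base (d : Order.disp_t) (P : finPOrderType d) :
    ladder_like P -> series_ladder P
| series_ladder_series (d : Order.disp_t) (n : nat) (S : 'I_n -> finPOrderType d) :
    (forall i : 'I_n, series_ladder (S i)) -> series_ladder (series_comp S)
| series_ladder_iso (d d' : Order.disp_t) (P : finPOrderType d)
    (P' : finPOrderType d') :
    poset_iso P P' -> series_ladder P -> series_ladder P'.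

Fixpoint ff_insert (d : Order.disp_t) (P : finPOrderType d) (Cs : seq {set P})
    (x : P) : seq {set P} :=
  if Cs is C :: Cs' then
    if is_chain (x |: C) then (x |: C) :: Cs' else C :: ff_insert Cs' x
  else [:: [set x]%SET].

Definition first_fit (d : Order.disp_t) (P : finPOrderType d) (s : seq P) :
    seq {set P} :=
  foldl (@ff_insert d P) [::] s.

(* A presentation order is a duplicate-free list of all the elements of [P]. *)
Definition ff_counts (w : nat) (d : Order.disp_t) (Q : finPOrderType d) : set nat :=
  [set k : nat | exists (d' : Order.disp_t) (P : finPOrderType d') (s : seq P),
    [/\ width P = w, poset_free Q P, perm_eq s (enum P)
      & k = size (first_fit s)]]%classic.

Local Open Scope ring_scope.

(* The adjoined 0 only matters when no poset qualifies; a nonempty bounded set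
   of naturals attains its supremum, and an unbounded one has supremum +oo. *)
Definition FF (R : realType) (w : nat) (d : Order.disp_t) (Q : finPOrderType d) :
    \bar R :=
  ereal_sup [set (k%:R)%:E | k in 0%N |` ff_counts w Q]%classic.

Definition lg (R : realType) (x : R) : R := ln x / ln 2.

(* Main.v *)
(* First-Fit colours a poset so that every element has, for each smaller colour,
   an incomparable element of that colour; call this a wall.

   Upper bound. Let a wall of width at most w contain no ladder with m rungs. The
   top colours contain a maximum antichain A, and every lower colour has an
   element incomparable to at least half of A. For many colours this half is the
   same, A1. The region of elements incomparable to all of A1 has at most half the
   width, but a witness may lie outside of it. If, for a down-set D, the colours
   whose witnesses must leave D formed a long chain under domination, the last
   elements inside and the first elements outside D would be the rails of a long
   ladder; by Mirsky's theorem a fraction 1/(w m) of the colours is therefore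
   still a wall inside D. Cutting from above and from below yields a wall of half
   the width, hence (w m)^(O(lg w)) colours. If only a series composition of
   ladders is excluded, the poset is layered into ladder-free parts, and the same
   cutting argument bounds the number of colours by the product over the layers.

   Lower bound. From a poset of width w with a wall of M colours one builds a poset
   of width w + 1 with 2 M + 1 colours by putting a chain beside a series of
   blocks, all of whose subposets of width 2 remain in the family. *)
Require Import Defs.
From HB Require Import structures.
From mathcomp Require Import all_classical all_reals all_analysis.
From mathcomp Require Import all_boot all_order all_algebra zify ring.

Set Implicit Arguments.
Unset Strict Implicit.
Unset Printing Implicit Defensive.

Import Order.TTheory GRing.Theory Num.Theory.

Local Open Scope order_scope.

(** * Chains, antichains and walls *)

(** The elements of [S] without an [R]-successor in [S] form an antichain. A chain among the others
    is prolonged by a successor of its top element, so their removal lowers the bound on chains by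
    one. *)
Lemma mirsky (C : finType) (R : rel C) (S : {set C}) (l a : nat) :
    irreflexive R -> transitive R ->
    (forall K : {set C}, K \subset S ->
       {in K &, forall x y, x != y -> R x y || R y x} -> (#|K| <= l)%N) ->
    (forall Y : {set C}, Y \subset S ->
       {in Y &, forall x y, ~~ R x y} -> (#|Y| <= a)%N) ->
  (#|S| <= l * a)%N.
Proof.
move=> irrR trR; elim: l S => [|l IH] S chS acS.
  case: (set_0Vmem S) => [->|[c cS]]; first by rewrite cards0.
  have := chS [set c]%SET; rewrite cards1 sub1set => /(_ cS) chc.
  suff: (1 <= 0)%N by []; apply: chc => x y /set1P-> /set1P->.
  by rewrite eqxx.
pose M := [set c in S | [forall (d | d \in S), ~~ R c d]]%SET.
have MS : M \subset S by apply/subsetP => x; rewrite inE => /andP[].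
have cM : (#|M| <= a)%N.
  apply: acS => // x y; rewrite !inE => /andP[_ /forall_inP xM] /andP[yS _].
  exact: xM.
rewrite -(cardsID M S) (setIidPr MS) mulSn leq_add //; apply: IH.
- move=> K KSM chK.
  have [->|[k0 k0K]] := set_0Vmem K; first by rewrite cards0.
  have KS : K \subset S by apply: subset_trans KSM (subsetDl _ _).
  (* The top of [K] is found as the element with the fewest successors in [K]. *)
  have [c cK cmax] : exists2 c, c \in K & forall d, d \in K -> ~~ R c d.
    pose f c := #|[set d in K | R c d]%SET|.
    case: (arg_minnP (P := mem K) f k0K) => c cK cmin; exists c => // d dK.
    apply/negP => Rcd; have := cmin d dK; rewrite leqNgt; move/negP; apply.
    apply: proper_card; apply/properP; split.
      by apply/subsetP => e; rewrite !inE => /andP[-> /(trR _ _ _ Rcd)].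
    by exists d; rewrite !inE dK ?irrR.
  have : c \notin M by move/subsetP: KSM => /(_ _ cK); rewrite inE => /andP[].
  rewrite inE (subsetP KS c cK) /= => /forall_inPn[d dS] /negbNE Rcd.
  have dK : d \notin K by apply/negP => /cmax; rewrite Rcd.
  rewrite -ltnS; have <- : #|(d |: K)%SET| = #|K|.+1 by rewrite cardsU1 dK.
  apply: chS; first by rewrite subUset sub1set dS.
  have Rd x : x \in K -> R x d.
    move=> xK; have [->//|xc] := eqVneq x c.
    have := chK _ _ xK cK xc; rewrite (negbTE (cmax _ xK)) orbF => Rxc.
    exact: trR Rcd.
  move=> x y /setU1P[->|xK] /setU1P[->|yK]; rewrite ?eqxx //.
  + by rewrite (Rd _ yK) orbT.
  + by rewrite (Rd _ xK).
  + exact: chK.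
- move=> Y YS acY; apply: acS => //.
  by apply: subset_trans YS (subsetDl _ _).
Qed.

Section Walls.
Variables (d : Order.disp_t) (T : finPOrderType d) (N : nat) (col : T -> 'I_N).
Implicit Types (W A X D : {set T}) (S K Y : {set 'I_N}).

(** The type of colours is fixed and [S] selects those in play, so that passing to fewer colours
    needs no renumbering. *)
Definition wall W S : Prop :=
  (forall c, c \in S -> exists2 x, x \in W & col x = c) /\
  (forall x (b : 'I_N), x \in W -> col x \in S -> b \in S -> (b < col x)%N ->
     exists y, [/\ y \in W, col y = b & x >< y]).

(* This is how a [b]-coloured witness can be forced outside a down-set [D]:
   an element of [D] all of whose [b]-coloured witnesses lie outside [D] has to
   be above every [b]-coloured element of [D]. *)
Definition dominated D (b t : 'I_N) : bool :=
  (b < t)%N && [exists p in D, (col p == t) &&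
    [forall r in D, (col r == b) ==> (r < p)]].

Lemma dominatedP D (b t : 'I_N) :
  reflect ((b < t)%N /\ exists p, [/\ p \in D, col p = t &
             forall r, r \in D -> col r = b -> r < p])
          (dominated D b t).
Proof.
apply: (iffP andP) => -[bt].
  case/exists_inP => p pD /andP[/eqP pt /forall_inP rp]; split=> //; exists p.
  by split=> // r rD rb; have := rp _ rD; rewrite rb eqxx.
case=> p [pD pt rp]; split=> //; apply/exists_inP; exists p => //.
rewrite pt eqxx /=; apply/forall_inP => r rD; apply/implyP => /eqP; exact: rp.
Qed.

Hypothesis colP : forall x y, col x = col y -> x >=< y.

Lemma wall_subset W S S' : S' \subset S -> wall W S -> wall W S'.
Proof.
move=> /subsetP sS [ne wit]; split=> [c /sS/ne//|x b xW xS bS bx].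
by apply: wit => //; apply: sS.
Qed.

Lemma chain_max (C : {set T}) : C != set0 -> {in C &, forall x y, x >=< y} ->
  exists2 q, q \in C & forall y, y \in C -> y <= q.
Proof.
case/set0Pn => q0 q0C chC.
pose f x := #|[set y in C | y <= x]%SET|.
case: (arg_maxnP (P := fun z => z \in C) f q0C) => q qC qmax; exists q => // y yC.
have := chC _ _ qC yC; case: comparableP => // qy _.
have := qmax y yC; rewrite /= leqNgt => /negP[]; apply: proper_card.
apply/properP; split; last by exists y; rewrite !inE yC ?lexx //= (lt_geF qy).
by apply/subsetP => z; rewrite !inE => /andP[-> /= /le_trans->] //; apply: ltW.
Qed.

Lemma chain_min (C : {set T}) : C != set0 -> {in C &, forall x y, x >=< y} ->
  exists2 q, q \in C & forall y, y \in C -> q <= y.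
Proof.
case/set0Pn => q0 q0C chC.
pose f x := #|[set y in C | y <= x]%SET|.
case: (arg_minnP (P := fun z => z \in C) f q0C) => q qC qmin; exists q => // y yC.
have := chC _ _ qC yC; case: comparableP => // qy _.
have := qmin y yC; rewrite /= leqNgt => /negP[]; apply: proper_card.
apply/properP; split; last by exists q; rewrite !inE qC ?lexx //= (lt_geF qy).
by apply/subsetP => z; rewrite !inE => /andP[-> /= /le_trans->] //; apply: ltW.
Qed.

Definition down_in D W : Prop :=
  D \subset W /\ (forall x y, x \in D -> y \in W -> y <= x -> y \in D).

(** Domination is transitive and [l] bounds its chains, so Mirsky's theorem applies. Among pairwise
    undominated colours, let [x] in [D] have a witness [v] outside [D]. Some [r] in [D] of the
    colour of [v] is not below [x]; as [r <= v], having [x < r] would give [x < v]. So [r] is a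
    witness inside [D]. *)
Lemma wall_cut W S D (l g : nat) : wall W S -> down_in D W ->
    (forall c, c \in S -> exists2 x, x \in D & col x = c) ->
    (forall Y, Y \subset S -> wall D Y -> (#|Y| <= g)%N) ->
    (forall K, K \subset S ->
       {in K &, forall b t : 'I_N, (b < t)%N -> dominated D b t} ->
       (#|K| <= l)%N) ->
  (#|S| <= l * g)%N.
Proof.
move=> [neW wit] [/subsetP DW downD] neD gY lK.
pose R b t := [&& b \in S, t \in S & dominated D b t].
apply: (mirsky (R := R)).
- by move=> b; rewrite /R /dominated ltnn !andbF.
- move=> t b s /and3P[bS tS /dominatedP[bt [p [pD pt bp]]]].
  case/and3P=> _ sS /dominatedP[ts [q [qD qs tq]]]; apply/and3P; split=> //.
  apply/dominatedP; split; first exact: ltn_trans ts.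
  exists q; split=> // r rD rb; exact: lt_trans (bp _ rD rb) (tq _ pD pt).
- move=> K KS chK; apply: lK => // b t bK tK bt.
  have := chK _ _ bK tK; rewrite -val_eqE neq_ltn bt => /(_ isT) /orP[/and3P[]//|].
  by case/and3P=> _ _ /dominatedP[tb _]; have := ltn_trans bt tb; rewrite ltnn.
- move=> Y /[dup] YS /subsetP sYS acY; apply: gY => //.
  split=> [c /sYS/neD//|x b xD xY bY bx].
  have [v [vW vb xv]] := wit x b (DW _ xD) (sYS _ xY) (sYS _ bY) bx.
  have [vD|vD] := boolP (v \in D); first by exists v.
  have := acY _ _ bY xY; rewrite /R (sYS _ bY) (sYS _ xY) /= => /negP ndom.
  case: (pickP [pred r in D | (col r == b) && ~~ (r < x)]); last first.
    move=> allr; case: ndom; apply/dominatedP; split=> //; exists x; split=> // r.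
    by move=> rD rb; have := allr r; rewrite inE /= rD rb eqxx /= => /negbFE.
  move=> r /and3P[rD /eqP rb rx].
  exists r; split=> //; apply/negP => xr.
  have rv : r <= v.
    have : r >=< v by apply: colP; rewrite rb vb.
    case/orP=> // vr; case/negP: vD; exact: downD vr.
  move: xr rx; case: comparableP => // [xr|rxe] _ _.
    by case/negP: xv; apply: le_comparable; apply: le_trans rv; apply: ltW.
  by move: bx; rewrite -rb rxe ltnn.
Qed.

(** An element above all [b]-coloured elements of [D] has its [b]-coloured witness outside [D]. An
    element outside [D] is above every element of [D] of its own colour, so it inherits this from
    the dominating one. The top colour [t] is dropped, since nothing forces it to occur outside
    [D]. *)
Lemma wall_above_dominated W S D K (t : 'I_N) : wall W S -> down_in D W ->
    K \subset S -> t \in K -> (forall b, b \in K -> (b <= t)%N) ->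
    {in K &, forall b t : 'I_N, (b < t)%N -> dominated D b t} ->
  wall (W :\: D) (K :\ t).
Proof.
move=> [neW wit] [/subsetP DW downD] /subsetP KS tK tmax dom.
split=> [c|x b].
  rewrite !inE => /andP[ct cK].
  have lct : (c < t)%N by rewrite ltn_neqAle (tmax _ cK) andbT.
  have /dominatedP[_ [p [pD pt cp]]] := dom _ _ cK tK lct.
  have := wit p c (DW _ pD); rewrite pt => /(_ (KS _ tK) (KS _ cK) lct).
  case=> v [vW vc pv].
  exists v => //; rewrite inE vW andbT; apply: contra pv => vD.
  by rewrite comparable_sym lt_comparable // cp.
rewrite !inE => /andP[xD xW] /andP[xt xK] /andP[bt bK] bx.
have /dominatedP[_ [p [pD px bp]]] := dom _ _ bK xK bx.
have [v [vW vb xv]] := wit x b xW (KS _ xK) (KS _ bK) bx.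
exists v; split=> //; rewrite inE vW andbT; apply: contra xv => vD.
have : x >=< p by exact: colP.
case/orP=> [xp|px']; first by case/negP: xD; exact: downD xp.
by rewrite comparable_sym lt_comparable // (lt_le_trans _ px') // bp.
Qed.

End Walls.

(** * Ladders and the length of domination chains *)

Section Ladders.
Variables (d : Order.disp_t) (T : finPOrderType d).
Implicit Types (W A X D : {set T}).

Definition width_le W (w : nat) : Prop :=
  forall A, A \subset W -> is_antichain A -> (#|A| <= w)%N.

Lemma antichainP A :
  reflect {in A &, forall x y, x >=< y -> x = y} (is_antichain A).
Proof.
apply: (iffP forall_inP) => [acA x y xA yA xy|acA x xA].
  by have /forall_inP/(_ _ yA)/implyP/(_ xy)/eqP := acA _ xA.
by apply/forall_inP => y yA; apply/implyP => xy; apply/eqP; apply: acA.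
Qed.

Lemma width_leS W W' w : W' \subset W -> width_le W w -> width_le W' w.
Proof. by move=> W'W wW A AW'; apply: wW; apply: subset_trans W'W. Qed.

(* Only the indices below [m] matter. *)
Definition ladder W (m : nat) (x y : nat -> T) : Prop :=
  forall i, (i < m)%N -> [/\ x i \in W, y i \in W & forall j, (j < m)%N ->
    [/\ (x i <= x j) = (i <= j)%N, (y i <= y j) = (i <= j)%N,
        (x i <= y j) = (i <= j)%N & (y i <= x j) = false]].

Definition ladder_free W m : Prop := forall x y, ~ ladder W m x y.

Lemma ladder_freeS W W' m : W' \subset W -> ladder_free W m -> ladder_free W' m.
Proof.
move=> /subsetP sW lf x y lad; apply: (lf x y) => i im.
by have [xi yi ij] := lad i im; split=> //; apply: sW.
Qed.

Variables (N : nat) (col : T -> 'I_N).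
Hypothesis colP : forall x y, col x = col y -> x >=< y.

(* With [q c] the highest element of colour [c] in [D] and [n c] the lowest one
   outside [D], a domination chain [b < t] gives [q b < q t] and makes [n b]
   incomparable to [q t]; so wherever the [n c] form a chain, [q] and [n] are the
   two rails of a ladder. *)
Lemma dominated_chain_card W (S : {set 'I_N}) D (K : {set 'I_N}) (m w : nat) :
    wall col W S -> down_in D W ->
    (forall c, c \in S -> exists2 x, x \in D & col x = c) ->
    K \subset S ->
    {in K &, forall b t : 'I_N, (b < t)%N -> dominated col D b t} ->
    width_le W w -> ladder_free W m -> (0 < w)%N -> (0 < m)%N ->
  (#|K| <= w * m)%N.
Proof.
move=> wallW dDW neD KS dom wW lf w0 m0.
have [->|[t0 t0K]] := set_0Vmem K; first by rewrite cards0.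
have [t tK tmax] : exists2 t : 'I_N, t \in K & forall b : 'I_N, b \in K -> (b <= t)%N.
  by case: (arg_maxnP (P := fun z => z \in K) val t0K) => t tK tmax; exists t.
(* [z0] is a default value for [q] and [n] outside the colours that matter. *)
have [z0 _ _] := neD t (subsetP KS _ tK).
have wallE := wall_above_dominated colP wallW dDW KS tK tmax dom.
have KSs := subsetP KS.
have [[neW wit] [DW downD]] := (wallW, dDW).
have DWs := subsetP DW.
have /fin_all_exists[q qP] c : exists q, c \in K ->
    [/\ q \in D, col q = c & forall y, y \in D -> col y = c -> y <= q].
  have [cK|] := boolP (c \in K); last by exists z0.
  have [z zD zc] := neD _ (KSs _ cK).
  have [| |q] := @chain_max _ T [set y in D | col y == c]%SET.
  - by apply/set0Pn; exists z; rewrite inE zD zc eqxx.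
  - move=> u v; rewrite !inE => /andP[_ /eqP uc] /andP[_ /eqP vc].
    by apply: colP; rewrite uc vc.
  rewrite inE => /andP[qD /eqP qc] qmax; exists q => _; split=> // y yD yc.
  by apply: qmax; rewrite inE yD yc eqxx.
have /fin_all_exists[n nP] c : exists n, c \in K :\ t ->
    [/\ n \in W :\: D, col n = c &
        forall y, y \in W :\: D -> col y = c -> n <= y].
  have [cK|] := boolP (c \in K :\ t); last by exists z0.
  have [z zD zc] := wallE.1 _ cK.
  have [| |n] := @chain_min _ T [set y in W :\: D | col y == c]%SET.
  - by apply/set0Pn; exists z; rewrite inE zD zc eqxx.
  - move=> u v; rewrite !inE => /andP[_ /eqP uc] /andP[_ /eqP vc].
    by apply: colP; rewrite uc vc.
  rewrite inE => /andP[nD /eqP nc] nmin; exists n => _; split=> // y yD yc.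
  by apply: nmin; rewrite inE yD yc eqxx.
have K'K c : c \in K :\ t -> c \in K by rewrite inE => /andP[].
have qq (b c : 'I_N) : b \in K -> c \in K -> (b < c)%N -> q b < q c.
  move=> bK cK bc; have [qbD qbb _] := qP _ bK; have [qcD qcc qcmax] := qP _ cK.
  have /dominatedP[_ [p [pD pc bp]]] := dom _ _ bK cK bc.
  by apply: lt_le_trans (bp _ qbD qbb) _; apply: qcmax.
have nDF c x : c \in K :\ t -> x \in D -> (n c <= x) = false.
  move=> cK xD; apply/negP => nx; have [+ _ _] := nP _ cK.
  rewrite inE => /andP[/negP nD nW]; apply: nD; exact: downD xD nW nx.
have qn c : c \in K :\ t -> q c < n c.
  move=> cK; have [qD qc _] := qP _ (K'K _ cK); have [_ nc _] := nP _ cK.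
  have : q c >=< n c by apply: colP; rewrite qc nc.
  by have := nDF _ _ cK qD; case: comparableP.
(* The [b]-coloured witness [v] of [q c] lies outside [D], because the [b]-coloured elements of [D]
   are below [q c]. Hence [n b <= v], and [q c <= n b] would make [q c] comparable to [v]. *)
have nqF (b c : 'I_N) : b \in K :\ t -> c \in K -> (b < c)%N -> (q c <= n b) = false.
  move=> bK cK bc; have bK' := K'K _ bK; have [qD qc _] := qP _ cK.
  have [nbW nbb nbmin] := nP _ bK.
  have := wit (q c) b (DWs _ qD); rewrite qc => /(_ (KSs _ cK) (KSs _ bK') bc).
  case=> v [vW vb qv]; apply/negP => qnb; case/negP: (qv).
  apply: le_comparable; apply: le_trans qnb _; apply: nbmin => //.
  rewrite inE vW andbT; apply: contra qv => vD.
  have [qbD qbb qbmax] := qP _ bK'.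
  rewrite comparable_sym lt_comparable //.
  exact: le_lt_trans (qbmax _ vD vb) (qq _ _ bK' cK bc).
have nnF (b c : 'I_N) : b \in K :\ t -> c \in K :\ t -> (b < c)%N -> (n c <= n b) = false.
  move=> bK cK bc; apply/negP => ncb.
  have := nqF _ _ bK (K'K _ cK) bc.
  by rewrite (le_trans (ltW (qn _ cK)) ncb).
have -> : #|K| = #|K :\ t|.+1 by rewrite (cardsD1 t K) tK.
(* Leaving out [t] costs one colour, which [w * m] absorbs as [w] is positive. For the order given
   by colour and by [n] together, a chain of [m] colours is a ladder, and an antichain of colours
   gives an antichain of points [n c]. *)
suff : (#|K :\ t| <= m.-1 * w)%N by nia.
pose R (b c : 'I_N) := [&& b \in K :\ t, c \in K :\ t, (b < c)%N & n b < n c].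
apply: (mirsky (R := R)).
- by move=> b; rewrite /R ltnn !andbF.
- move=> c b e /and4P[bK cK bc nbc] /and4P[_ eK ce nce].
  by apply/and4P; split=> //; [apply: ltn_trans ce|apply: lt_trans nce].
- move=> L LK chL; rewrite -ltnS prednK // ltnNge; apply/negP => mL.
  pose c i := nth t (enum L) i.
  have cL i : (i < m)%N -> c i \in L.
    by move=> im; rewrite -mem_enum mem_nth // -cardE (leq_trans im).
  have cK i : (i < m)%N -> c i \in K :\ t.
    by move=> im; apply: (subsetP LK); apply: cL.
  have csort : sorted (fun u v : 'I_N => (u < v)%N) (enum L).
    have -> : enum L = [seq u <- enum 'I_N | u \in L] by rewrite enumT.
    apply: sorted_filter; first by move=> u v z; apply: ltn_trans.
    by have := iota_ltn_sorted 0 N; rewrite -val_enum_ord sorted_map.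
  have clt i j : (i < j)%N -> (j < m)%N -> (c i < c j)%N.
    move=> ij jm; apply: (sorted_ltn_nth _ t csort) => //.
    - by move=> u v w'; apply: ltn_trans.
    - by rewrite inE -cardE (leq_trans _ mL) // (ltn_trans ij).
    - by rewrite inE -cardE (leq_trans _ mL).
  have nlt i j : (i < j)%N -> (j < m)%N -> n (c i) < n (c j).
    move=> ij jm; have im := ltn_trans ij jm; have cij := clt _ _ ij jm.
    have := chL _ _ (cL _ im) (cL _ jm); rewrite -val_eqE neq_ltn cij => /(_ isT).
    by case/orP => /and4P[] // _ _ cji; have := ltn_trans cij cji; rewrite ltnn.
  apply: (lf (q \o c) (n \o c)) => i im.
  have [qD _ _] := qP _ (K'K _ (cK _ im)); have [nW _ _] := nP _ (cK _ im).
  split; [exact: DWs|by move: nW; rewrite inE => /andP[]|] => j jm /=.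
  have [qjD _ _] := qP _ (K'K _ (cK _ jm)).
  have [ij|ji|<-] := ltngtP i j.
  + have qij : q (c i) < q (c j) by apply: qq; rewrite ?K'K ?cK ?clt.
    split; [by rewrite ltW|by rewrite ltW ?nlt| |by rewrite nDF ?cK].
    by rewrite ltW // (lt_trans qij) // qn ?cK.
  + split; [|by rewrite lt_geF // nlt| |by rewrite nDF ?cK].
    * by rewrite lt_geF // qq ?K'K ?cK ?clt.
    * by rewrite nqF ?K'K ?cK ?clt.
  + by rewrite !lexx nDF ?cK // ltW // qn // cK.
- move=> Y YK acY.
  have YKs := subsetP YK.
  have ncol b : b \in Y -> col (n b) = b by case/YKs/nP.
  rewrite -(card_in_imset (f := n)); last first.
    by move=> b c bY cY nbc; rewrite -(ncol b bY) -(ncol c cY) nbc.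
  apply: wW.
    apply/subsetP => _ /imsetP[b bY ->].
    by have [+ _ _] := nP _ (YKs _ bY); rewrite inE => /andP[].
  have key (b c : 'I_N) : b \in Y -> c \in Y -> (b < c)%N -> n b >< n c.
    move=> bY cY bc; have := acY _ _ bY cY; rewrite /R !YKs //= bc /= => nbc.
    have := nnF _ _ (YKs _ bY) (YKs _ cY) bc.
    by move: nbc; case: comparableP.
  apply/antichainP => _ _ /imsetP[b bY ->] /imsetP[c cY ->] nbc.
  have [bc|cb|/val_inj-> //] := ltngtP b c.
  + by have := key _ _ bY cY bc; rewrite nbc.
  + by have := key _ _ cY bY cb; rewrite comparable_sym nbc.
Qed.

End Ladders.

(** * Half-witnesses, and cuts in the absence of long ladders *)

Section Cuts.
Variables (d : Order.disp_t) (T : finPOrderType d) (N : nat) (col : T -> 'I_N).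
Implicit Types (W A X D : {set T}) (S K Y : {set 'I_N}).
Hypothesis colP : forall x y, col x = col y -> x >=< y.

(* No element of [A] lies between the last element of colour [c] that is below
   some element of [A] and the next element of colour [c]. *)
Lemma half_witness A W (c : 'I_N) : is_antichain A -> A != set0 ->
    (forall a, a \in A -> exists y, [/\ y \in W, col y = c & a >< y]) ->
  exists v, [/\ v \in W, col v = c &
    (#|A| <= 2 * #|[set a in A | a >< v]%SET|)%N].
Proof.
move=> /antichainP acA /set0Pn[a0 a0A] wit.
pose C := [set y in W | col y == c]%SET.
have chC : {in C &, forall x y, x >=< y}.
  move=> x y; rewrite !inE => /andP[_ /eqP xc] /andP[_ /eqP yc].
  by apply: colP; rewrite xc yc.
have witC a : a \in A -> exists2 y, y \in C & a >< y.
  by case/wit=> y [yW yc ay]; exists y => //; rewrite inE yW yc eqxx.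
suff [v vC hv] : exists2 v, v \in C & (#|A| <= 2 * #|[set a in A | a >< v]%SET|)%N.
  by move: vC; rewrite inE => /andP[vW /eqP vc]; exists v.
pose U v := [set a in A | v <= a]%SET.
pose L v := [set a in A | a <= v]%SET.
have C0 : C != set0 by have [y yC _] := witC _ a0A; apply/set0Pn; exists y.
(* If no element of colour [c] is below an element of [A], the lowest one is incomparable to all of
   [A]. Otherwise [q] is the last one below an element of [A], and [n] is the next one. *)
have [Q0|Q0] := eqVneq [set y in C | U y != set0]%SET set0.
  have [v vC vmin] := chain_min C0 chC; exists v => //.
  suff -> : [set a in A | a >< v]%SET = A by lia.
  apply/setP => a; rewrite inE; case: (boolP (a \in A)) => //= aA.
  have [y yC ay] := witC _ aA; apply: contra ay => /orP[av|va].
    by apply: le_comparable; apply: le_trans (vmin _ yC).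
  have : v \in [set y in C | U y != set0]%SET.
    by rewrite inE vC; apply/set0Pn; exists a; rewrite inE aA.
  by rewrite Q0 inE.
have [| q] := chain_max Q0.
  by move=> x y /setIdP[xC _] /setIdP[yC _]; apply: chC.
case/setIdP=> qC /set0Pn[a1 /setIdP[a1A qa1]] qmax.
have gtq y : y \in C -> ~~ (y <= q) -> y \in [set y in C | q < y]%SET.
  by move=> yC yq; rewrite inE yC /=; have := chC _ _ qC yC; move: yq; case: comparableP.
have nyq a y : q <= a -> a >< y -> ~~ (y <= q).
  move=> qa ay; apply: contra ay => yq.
  by rewrite comparable_sym le_comparable // (le_trans yq).
have [N0|N0] := eqVneq [set y in C | q < y]%SET set0.
  have [y yC a1y] := witC _ a1A.
  by have := gtq y yC (nyq _ _ qa1 a1y); rewrite N0 inE.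
have [| n] := chain_min N0.
  by move=> x y /setIdP[xC _] /setIdP[yC _]; apply: chC.
case/setIdP=> nC qn nmin.
have Iq a : a \in A -> ~~ (q <= a) -> a >< q.
  move=> aA qa; apply/negP => /orP[aq|]; last exact/negP.
  have aa1 : a = a1 by apply: acA => //; apply: le_comparable; apply: le_trans qa1.
  by case/negP: qa; rewrite aa1.
have In a : a \in A -> ~~ (a <= n) -> a >< n.
  move=> aA an; apply/negP => /orP[|na]; first exact/negP.
  suff nq : n <= q by have := lt_le_trans qn nq; rewrite ltxx.
  apply: qmax; rewrite inE nC; apply/set0Pn; exists a; rewrite inE aA; exact: na.
(* An [a] above [q] has its witness strictly above [q], hence at or above [n], so [a] cannot be
   below [n]. An [a] not above [q] is incomparable to [q]. One of [q] and [n] therefore serves half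
   of [A]. *)
have AU : A \subset [set a in A | a >< q]%SET :|: [set a in A | a >< n]%SET.
  apply/subsetP => a aA; rewrite !inE aA /=.
  have [qa|/(Iq _ aA)-> //] := boolP (q <= a).
  rewrite (In a) ?orbT //; apply/negP => an; have [y yC ay] := witC _ aA.
  have /nmin ny := gtq y yC (nyq _ _ qa ay).
  by case/negP: ay; apply: le_comparable; apply: le_trans ny.
have := leq_trans (subset_leq_card AU) (leq_card_setU _ _).
have [le|lt] := leqP #|A| (2 * #|[set a in A | a >< q]%SET|).
  by move=> _; exists q.
by move=> AA; exists n => //; lia.
Qed.

Lemma ladder_cut W S D (m w g : nat) : wall col W S -> down_in D W ->
    (forall c, c \in S -> exists2 x, x \in D & col x = c) ->
    width_le W w -> ladder_free W m -> (0 < w)%N -> (0 < m)%N ->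
    (forall Y, Y \subset S -> wall col D Y -> (#|Y| <= g)%N) ->
  (#|S| <= w * m * g)%N.
Proof.
move=> wallW dDW neD wW lf w0 m0 gD; apply: (wall_cut colP wallW dDW) => //.
by move=> K KS dom; apply: (dominated_chain_card colP wallW dDW neD KS).
Qed.

End Cuts.

Section Duality.
Variables (d : Order.disp_t) (T : finPOrderType d).

Lemma width_le_dual (W : {set T}) w : width_le W w -> width_le (T := T^d) W w.
Proof.
move=> wW A AW /antichainP acA; apply: wW => //.
by apply/antichainP => x y xA yA; rewrite comparable_sym; apply: acA.
Qed.

(** Reversing the order swaps the two rails and reverses their indexing. *)
Lemma ladder_free_dual (W : {set T}) m :
  ladder_free W m -> ladder_free (T := T^d) W m.
Proof.
move=> lf x y lad; apply: (lf (fun i => y (m.-1 - i)%N) (fun i => x (m.-1 - i)%N)).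
move=> i im; have im' : (m.-1 - i < m)%N by lia.
have [xi yi ij] := lad _ im'; split=> // j jm.
have jm' : (m.-1 - j < m)%N by lia.
have [_ _ ji] := lad _ jm'.
have [h1 h2 h3 h4] := ij _ jm'; have [k1 k2 k3 k4] := ji _ im'.
have -> : (i <= j)%N = (m.-1 - j <= m.-1 - i)%N by lia.
by split.
Qed.

Lemma wall_dual N (col : T -> 'I_N) (W : {set T}) S :
  wall col W S <-> wall (T := T^d) col W S.
Proof.
split=> -[ne wit]; split=> // x b xW xS bS bx;
  have [y [yW yb xy]] := wit x b xW xS bS bx; exists y; split=> //;
  by rewrite comparable_sym.
Qed.

End Duality.

(** * Walls without long ladders, by halving the width *)

Section Parallel.
Variables (d : Order.disp_t) (T : finPOrderType d) (N : nat) (col : T -> 'I_N).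
Implicit Types (W A X D : {set T}) (S K Y : {set 'I_N}).
Hypothesis colP : forall x y, col x = col y -> x >=< y.

Lemma ladder_cut_up W S D (m w g : nat) : wall col W S -> D \subset W ->
    (forall x y, x \in D -> y \in W -> x <= y -> y \in D) ->
    (forall c, c \in S -> exists2 x, x \in D & col x = c) ->
    width_le W w -> ladder_free W m -> (0 < w)%N -> (0 < m)%N ->
    (forall Y, Y \subset S -> wall col D Y -> (#|Y| <= g)%N) ->
  (#|S| <= w * m * g)%N.
Proof.
move=> wallW DW upD neD wW lf w0 m0 gD.
apply: (@ladder_cut _ T^d _ col _ W S D m w g) => //.
- by move=> x y /colP; rewrite comparable_sym.
- exact/wall_dual.
- exact: width_le_dual.
- exact: ladder_free_dual.
- by move=> Y YS /wall_dual; apply: gD.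
Qed.

(** Two cuts reach the region, each at the cost of a factor [w * m]: [R1] is a down-set of [W], and
    the region is an up-set of [R1]. The given [v] show that every colour of [S] occurs there. *)
Lemma parallel_region_card W S A1 (m w g : nat) : wall col W S ->
    width_le W w -> ladder_free W m -> (0 < w)%N -> (0 < m)%N ->
    (forall c, c \in S -> exists v,
      [/\ v \in W, col v = c & forall a, a \in A1 -> a >< v]) ->
    (forall Y, wall col [set p in W | [forall (a | a \in A1), a >< p]]%SET Y ->
       (#|Y| <= g)%N) ->
  (#|S| <= w * m * (w * m * g))%N.
Proof.
move=> wallW wW lf w0 m0 vP gR.
pose R1 := [set p in W | [forall (a | a \in A1), ~~ (a <= p)]]%SET.
pose R := [set p in W | [forall (a | a \in A1), a >< p]]%SET.
have R1W : R1 \subset W by apply/subsetP => p; rewrite inE => /andP[].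
have RR1 : R \subset R1.
  apply/subsetP => p; rewrite !inE => /andP[-> /forall_inP ap].
  apply/forall_inP => a aA; apply: contra (ap _ aA); exact: le_comparable.
have neR c : c \in S -> exists2 x, x \in R & col x = c.
  case/vP=> v [vW vc av]; exists v => //; rewrite inE vW; exact/forall_inP.
apply: (ladder_cut colP wallW (D := R1)) => //.
- split=> // x y; rewrite !inE => /andP[xW /forall_inP ax] yW yx; rewrite yW.
  apply/forall_inP => a aA; apply: contra (ax _ aA) => ay; exact: le_trans yx.
- by move=> c /neR[x xR xc]; exists x => //; apply: (subsetP RR1).
- move=> Y YS wallY; apply: (ladder_cut_up wallY (D := R)) => //.
  + move=> x y; rewrite !inE => /andP[xW /forall_inP ax] /andP[yW /forall_inP ay] xy.
    rewrite yW; apply/forall_inP => a aA; apply/negP => /orP[ay'|ya].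
      by case/negP: (ay _ aA).
    case/negP: (ax _ aA); rewrite comparable_sym; apply: le_comparable; exact: le_trans ya.
  + by move=> c cY; apply: neR; apply: (subsetP YS).
  + exact: width_leS R1W wW.
  + exact: ladder_freeS R1W lf.
  + by move=> Y' _; apply: gR.
Qed.

Lemma card_fibers (I J : finType) (f : I -> J) (K : {set I}) (B : nat) :
  (forall j, #|[set i in K | f i == j]%SET| <= B)%N -> (#|K| <= #|J| * B)%N.
Proof.
move=> fB; rewrite -sum1_card (partition_big f predT) //=.
rewrite -sum_nat_const; apply: leq_sum => j _; rewrite sum1_card.
by apply: leq_trans (fB j); rewrite cardsE.
Qed.

(* Many half-witnesses form a chain, along which the sets of elements of [A] above
   (or below) them are nested and hence determined by their cardinals; so many of
   them are incomparable to the same part of [A]. *)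
Lemma parallel_card W S A (m w g : nat) : wall col W S ->
    A \subset W -> is_antichain A -> A != set0 ->
    (forall a c, a \in A -> c \in S -> exists y, [/\ y \in W, col y = c & a >< y]) ->
    width_le W w -> ladder_free W m -> (0 < w)%N -> (0 < m)%N ->
    (forall (R : {set T}) Y, R \subset W -> wall col R Y ->
      (forall X : {set T}, X \subset R -> is_antichain X -> (2 * #|X| + #|A| <= 2 * w)%N) ->
      (#|Y| <= g)%N) ->
  (#|S| <= w.+1 ^ 2 * (w * m * (w * m * g)) * w)%N.
Proof.
move=> wallW AW acA A0 witA wW lf w0 m0 gR.
have [a0 a0A] := set0Pn _ A0.
have /fin_all_exists[v vP] c : exists v, c \in S -> [/\ v \in W, col v = c &
    (#|A| <= 2 * #|[set a in A | a >< v]%SET|)%N].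
  have [cS|] := boolP (c \in S); last by exists a0.
  have [|v vP] := half_witness colP (W := W) (c := c) acA A0; last by exists v.
  by move=> a aA; apply: witA.
pose R b c := [&& b \in S, c \in S & v b < v c].
apply: (mirsky (R := R)).
- by move=> b; rewrite /R ltxx !andbF.
- by move=> c b e /and3P[bS _ bc] /and3P[_ eS ce]; rewrite /R bS eS (lt_trans bc).
- move=> K KS chK; have KSs := subsetP KS.
  pose U c := [set a in A | v c <= a]%SET.
  pose L c := [set a in A | a <= v c]%SET.
  have UA c : U c \subset A by apply/subsetP => a; rewrite inE => /andP[].
  have LA c : L c \subset A by apply/subsetP => a; rewrite inE => /andP[].
  have Aw : (#|A| <= w)%N by apply: wW.
  (* The sets [U] and [L] are nested along the chain, so their cardinals determine them; the number
     of pairs of cardinals is the factor [w.+1 ^ 2]. *)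
  pose f c : 'I_w.+1 * 'I_w.+1 := (inord #|U c|, inord #|L c|).
  have fE b c : f b = f c -> #|U b| = #|U c| /\ #|L b| = #|L c|.
    have ltw (X : {set T}) : X \subset A -> (#|X| < w.+1)%N.
      by move=> /subset_leq_card XA; rewrite ltnS (leq_trans XA).
    by case=> /(congr1 val) + /(congr1 val); rewrite /= !inordK // ltw.
  have UL b c : b \in K -> c \in K -> f b = f c -> U b = U c /\ L b = L c.
    wlog bc : b c / v b <= v c => [hw bK cK fbc|bK cK /fE[Ubc Lbc]].
      have [<-//|bc] := eqVneq b c.
      have := chK _ _ bK cK bc; rewrite /R => /orP[]/and3P[_ _ /ltW vbc].
        exact: hw.
      by have [-> ->] := hw _ _ vbc cK bK (esym fbc).
    split; [apply/esym|]; apply/eqP; rewrite eqEcard ?Ubc ?Lbc leqnn andbT;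
      apply/subsetP => a; rewrite !inE => /andP[-> /=].
      exact: le_trans.
    by move=> ab; apply: le_trans bc.
  have IUL c : [set a in A | a >< v c]%SET = A :\: (U c :|: L c).
    apply/setP => a; rewrite !inE; case: (a \in A); rewrite ?andbF //=.
    by rewrite andbT comparable_sym.
  have -> : (w.+1 ^ 2 = #|{: 'I_w.+1 * 'I_w.+1}|)%N by rewrite card_prod !card_ord.
  apply: (card_fibers (f := f)) => j; set Kj := [set i in K | f i == j]%SET.
  have [->|[c0]] := set_0Vmem Kj; first by rewrite cards0.
  rewrite inE => /andP[c0K /eqP fc0]; pose A1 := [set a in A | a >< v c0]%SET.
  have KjS : Kj \subset S.
    by apply/subsetP => c; rewrite inE => /andP[/KSs].
  have A1E c : c \in Kj -> [set a in A | a >< v c]%SET = A1.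
    rewrite inE => /andP[cK /eqP fc]; have [UE LE] := UL c c0 cK c0K (etrans fc (esym fc0)).
    by rewrite /A1 !IUL UE LE.
  apply: (parallel_region_card (A1 := A1) (wall_subset KjS wallW) wW lf) => //.
    move=> c cK; have [vW vc _] := vP c (subsetP KjS _ cK).
    by exists (v c); split=> // a; rewrite -(A1E c cK) inE => /andP[].
  have RW : [set p in W | [forall (a | a \in A1), a >< p]]%SET \subset W.
    by apply/subsetP => p; rewrite inE => /andP[].
  move=> Y wallY; apply: gR wallY _ => //.
  move=> X XR /antichainP acX.
  have [_ _ A1A] := vP _ (KSs _ c0K); rewrite -/A1 in A1A.
  have XA1 a x : a \in A1 -> x \in X -> a >< x.
    by move=> aA /(subsetP XR); rewrite inE => /andP[_ /forall_inP/(_ _ aA)].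
  have dis : X :&: A1 = set0.
    apply/setP => x; rewrite in_setI in_set0; apply/negP => /andP[xX xA].
    by have := XA1 _ _ xA xX; rewrite comparablexx.
  (* [X] and [A1] are disjoint and form an antichain together, while [A1] is at least half of
     [A]. *)
  suff : (#|X| + #|A1| <= w)%N by lia.
  have A1A' : A1 \subset A by apply/subsetP => a; rewrite inE => /andP[].
  rewrite -cardsUI dis cards0 addn0; apply: wW.
    by rewrite subUset (subset_trans XR) ?(subset_trans A1A').
  move/antichainP: acA => acA; apply/antichainP => x y /setUP[xX|xA] /setUP[yX|yA] xy.
  + exact: acX.
  + by have := XA1 _ _ yA xX; rewrite comparable_sym xy.
  + by have := XA1 _ _ xA yX; rewrite xy.
  + by apply: acA; rewrite ?(subsetP A1A').
- move=> Y YS acY; have YSs := subsetP YS.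
  have vcol b : b \in Y -> col (v b) = b by case/YSs/vP.
  rewrite -(card_in_imset (f := v)); last first.
    by move=> b c bY cY vbc; rewrite -(vcol b bY) -(vcol c cY) vbc.
  apply: wW.
    by apply/subsetP => _ /imsetP[b /YSs/vP[vW _ _] ->].
  apply/antichainP => _ _ /imsetP[b bY ->] /imsetP[c cY ->].
  have := acY _ _ bY cY; have := acY _ _ cY bY; rewrite /R !YSs //=.
  by case: comparableP.
Qed.

Lemma top_colors (S : {set 'I_N}) (k : nat) : (k <= #|S|)%N ->
  exists Shi : {set 'I_N}, [/\ Shi \subset S, #|Shi| = k &
    forall b c : 'I_N, b \in S :\: Shi -> c \in Shi -> (b < c)%N].
Proof.
elim: k => [|k IHk] kS.
  by exists set0; split; rewrite ?sub0set ?cards0 // => b c _; rewrite inE.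
have [Shi [hiS cardhi ltlo]] := IHk (ltnW kS).
have : (0 < #|S :\: Shi|)%N by rewrite cardsD (setIidPr hiS) cardhi subn_gt0.
rewrite card_gt0 => /set0Pn[t0 t0P].
case: (arg_maxnP (P := fun z => z \in S :\: Shi) val t0P) => t tP tmax.
have /setDP[tS tN] := tP.
exists (t |: Shi)%SET; split; first by rewrite subUset sub1set tS.
  by rewrite cardsU1 tN cardhi.
move=> b c /setDP[bS]; rewrite in_setU1 negb_or => /andP[bt bN].
have bD : b \in S :\: Shi by rewrite inE bN.
case/setU1P=> [->|]; last exact: ltlo.
by rewrite ltn_neqAle bt; apply: tmax.
Qed.

(** The loss in [parallel_card], whose bound is [ladder_factor w m * g]. *)
Definition ladder_factor (w m : nat) : nat :=
  (w.+1 ^ 2 * (w * m * (w * m)) * w)%N.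

(** The cost of halving the width: with [k] the factor above and [g > 0] a bound at half the width,
    the bound [w * (1 + k * g)] is at most [ladder_base w m * g]. *)
Definition ladder_base (w m : nat) : nat := (w * (1 + ladder_factor w m))%N.

(* The top colours, if there are more of them than width [v] allows, contain an
   antichain of size [v + 1]; half of it is avoided by a region that carries a
   fixed fraction of the remaining colours and has at most half the width. *)
Lemma ladder_free_wall (m w0 : nat) : (0 < m)%N -> (0 < w0)%N ->
  forall l w W S, (w < 2 ^ l)%N -> (w <= w0)%N -> wall col W S ->
    width_le W w -> ladder_free W m -> (#|S| <= ladder_base w0 m ^ l)%N.
Proof.
move=> m0 w00; set H := ladder_base w0 m; set k := ladder_factor w0 m.
have H0 : (0 < H)%N by rewrite muln_gt0 w00.
elim=> [|l IH] w W S wl ww0 wallW wW lf.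
  have S0 : S = set0.
    apply/eqP/set0Pn => -[c cS]; have [x xW xc] := wallW.1 c cS.
    have := wW [set x]%SET; rewrite cards1 sub1set => /(_ xW).
    suff /[swap]/[apply] : is_antichain [set x]%SET by lia.
    by apply/antichainP => y z /set1P-> /set1P->.
  by rewrite S0 cards0.
(* For fixed [l], an induction on the width pays [1 + k * H ^ l] colours per unit of width. *)
suff inner v W' S' : (v < 2 ^ l.+1)%N -> (v <= w0)%N -> wall col W' S' ->
    width_le W' v -> ladder_free W' m -> (#|S'| <= v * (1 + k * H ^ l))%N.
  apply: leq_trans (inner _ _ _ wl ww0 wallW wW lf) _.
  rewrite expnS {2}/H /ladder_base -/k.
  have : (0 < H ^ l)%N by rewrite expn_gt0 H0.
  move: (H ^ l)%N => h h0.
  by rewrite -mulnA leq_mul // mulnDl mul1n leq_add2r.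
elim: v W' S' => [|v IHv] W' S' vl vw0 wallW' wW' lf'.
  have -> : S' = set0; last by rewrite cards0.
  apply/eqP/set0Pn => -[c cS]; have [x xW xc] := wallW'.1 c cS.
  have := wW' [set x]%SET; rewrite cards1 sub1set => /(_ xW).
  suff /[swap]/[apply] : is_antichain [set x]%SET by [].
  by apply/antichainP => y z /set1P-> /set1P->.
set B := (v * (1 + k * H ^ l))%N.
have [//|BS] := leqP #|S'| B; first by rewrite mulSn; lia.
(* [Shi] has [B + 1] colours, one more than width [v] allows, so its elements contain an antichain
   of size [v + 1]. *)
have [Shi [hiS cardhi ltlo]] := top_colors BS.
have hiSs := subsetP hiS.
pose Whi := [set x in W' | col x \in Shi]%SET.
have hiW : Whi \subset W' by apply/subsetP => x /setIdP[].
have wallhi : wall col Whi Shi.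
  have [ne wit] := wallW'; split=> [c cS|x b /setIdP[xW xS] _ bS bx].
    by have [x xW xc] := ne c (hiSs _ cS); exists x; rewrite // inE xW xc.
  have [y [yW yb xy]] := wit x b xW (hiSs _ xS) (hiSs _ bS) bx.
  by exists y; split=> //; rewrite inE yW yb.
have [A [AW acA vA]] : exists A : {set T}, [/\ A \subset Whi, is_antichain A & (v < #|A|)%N].
  case: (pickP [pred A : {set T} | [&& A \subset Whi, is_antichain A & (v < #|A|)%N]]).
    by move=> A /and3P[]; exists A.
  move=> none; suff : (#|Shi| <= B)%N by rewrite cardhi ltnn.
  apply: (IHv Whi); [exact: ltnW|exact: ltnW|by []| |exact: ladder_freeS lf'].
  by move=> A AW acA; have := none A; rewrite /= AW acA /= ltnNge => /negbFE.
have AW' := subset_trans AW hiW.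
have Av : #|A| = v.+1 by apply/eqP; rewrite eqn_leq vA andbT; apply: wW'.
have cardlo : (#|S' :\: Shi| <= k * H ^ l)%N.
  have wallD : wall col W' (S' :\: Shi) by apply: wall_subset wallW'; apply: subsetDl.
  apply: leq_trans (parallel_card (g := (H ^ l)%N) wallD AW' acA _ _ wW' lf' _ m0 _) _.
  - by rewrite -card_gt0 Av.
  - move=> a c /(subsetP AW)/setIdP[aW aS] cS.
    have [_ wit] := wallW'; apply: wit => //; first exact: hiSs.
      by move: cS => /setDP[].
    exact: ltlo.
  - by [].
  (* An antichain [X] of the region satisfies [2 * #|X| <= v + 1], and [v + 1 < 2 ^ l.+1]. *)
  - move=> R Y RW wallR wR; apply: (IH (v.+1)./2 R) => //.
    + by move: vl; rewrite expnS; lia.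
    + by lia.
    + by move=> X XR acX; have := wR X XR acX; rewrite Av; lia.
    + exact: ladder_freeS lf'.
  - rewrite /k /ladder_factor.
    have -> : (v.+2 ^ 2 * (v.+1 * m * (v.+1 * m * H ^ l)) * v.+1 =
               v.+2 ^ 2 * (v.+1 * m * (v.+1 * m)) * v.+1 * H ^ l)%N by nia.
    by rewrite leq_mul2r; apply/orP; right; rewrite !leq_mul // ?leq_exp2r.
rewrite -(cardsID Shi S') (setIidPr hiS) cardhi mulSn -/B.
by lia.
Qed.
End Parallel.

(** * Walls without a series composition of ladders *)

Section SeriesWall.
Variables (d : Order.disp_t) (T : finPOrderType d) (N : nat) (col : T -> 'I_N).
Implicit Types (W A X D : {set T}) (S K Y : {set 'I_N}).
Hypothesis colP : forall x y, col x = col y -> x >=< y.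

(** The colours missing from [D] form a wall outside [D], so there are at most [g2] of them. For the
    others, a domination chain without its top colour is a wall outside [D], so [wall_cut] leaves at
    most [(g2 + 1) * g1]. *)
Lemma wall_split W S D (g1 g2 : nat) : wall col W S -> down_in D W ->
    (forall Y, wall col D Y -> (#|Y| <= g1)%N) ->
    (forall Y, wall col (W :\: D) Y -> (#|Y| <= g2)%N) ->
  (#|S| <= (g1 + 1) * (g2 + 1))%N.
Proof.
move=> wallW dDW g1P g2P.
pose S1 := [set c in S | [exists x in D, col x == c]]%SET.
have S1P c : c \in S -> reflect (exists2 x, x \in D & col x = c) (c \in S1).
  move=> cS; rewrite inE cS; apply: (iffP exists_inP) => -[x xD /eqP xc];
    by exists x => //; apply/eqP.
have S1S : S1 \subset S by apply/subsetP => c /setIdP[].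
have S1le : (#|S1| <= (g2 + 1) * g1)%N.
  apply: (wall_cut colP (wall_subset S1S wallW) dDW).
  - by move=> c cS1; apply/S1P => //; apply: (subsetP S1S).
  - by move=> Y _; apply: g1P.
  - move=> K KS dom; have [->|[t0 t0K]] := set_0Vmem K; first by rewrite cards0.
    case: (arg_maxnP (P := fun z => z \in K) val t0K) => t tK tmax.
    rewrite (cardsD1 t K) tK addnC leq_add2r; apply: g2P.
    exact: (wall_above_dominated colP wallW dDW (subset_trans KS S1S) tK tmax dom).
suff S0le : (#|S :\: S1| <= g2)%N.
  by rewrite -(cardsID S1 S) (setIidPr S1S); lia.
apply: g2P; have [neW wit] := wallW.
have notD c x : c \in S :\: S1 -> x \in W -> col x = c -> x \in W :\: D.
  move=> /setDP[cS cS1] xW xc; rewrite inE xW andbT; apply: contra cS1 => xD.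
  by apply/S1P => //; exists x.
split=> [c cS|x b /setDP[xW xD] xS bS bx].
  by have /setDP[cS' _] := cS; have [x xW xc] := neW c cS'; exists x; rewrite ?(notD c).
have /setDP[xS' _] := xS; have /setDP[bS' _] := bS.
have [y [yW yb xy]] := wit x b xW xS' bS' bx; exists y; split=> //.
exact: notD yb.
Qed.

(* [W] contains the series composition of ladders of sizes [ms] followed by a
   single point. *)
Fixpoint has_series W (ms : seq nat) : Prop :=
  if ms is m :: ms' then
    exists x y, ladder W m x y /\ has_series [set p in W | y m.-1 < p]%SET ms'
  else exists x, x \in W.

Lemma has_seriesS W W' ms : W \subset W' -> has_series W ms -> has_series W' ms.
Proof.
elim: ms W W' => [|m ms IH] W W' WW' /=.
  by case=> x xW; exists x; apply: (subsetP WW').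
case=> x [y [lad hs]]; exists x, y; split.
  move=> i im; have [xi yi h] := lad i im.
  by split; rewrite ?(subsetP WW').
apply: IH hs; apply/subsetP => p /setIdP[pW yp].
by rewrite inE (subsetP WW').
Qed.

(** The argument is [m.+1] because the layer cut off for an [m]-ladder may still contain
    [m]-ladders. *)
Fixpoint series_bound (g : nat -> nat) (ms : seq nat) : nat :=
  if ms is m :: ms' then ((g m.+1 + 1) * (series_bound g ms' + 1))%N else 0%N.

(* The elements above no [m]-ladder form a down-set without [m.+1]-ladders. Since
   a ladder has a least element, the remaining up-set avoids the series
   composition of the other ladders. *)
Lemma series_free_wall (w l : nat) (ms : seq nat) W S :
    all (fun m => 0 < m)%N ms -> (0 < w)%N -> (w < 2 ^ l)%N ->
    width_le W w -> wall col W S -> ~ has_series W ms ->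
  (#|S| <= series_bound (fun m => ladder_base w m ^ l)%N ms)%N.
Proof.
move=> + w0 wl; elim: ms W S => [|m ms IH] W S /=.
  move=> _ wW [ne _] noW; rewrite leqn0 cards_eq0; apply/eqP/setP => c.
  rewrite in_set0; apply/negP => /ne[x xW _]; apply: noW; by exists x.
case/andP=> m0 ms0 wW wallW nohs.
pose below p := exists x y, ladder W m x y /\ y m.-1 < p.
pose D := [set p in W | ~~ `[< below p >]]%SET.
apply: (wall_split wallW (D := D)).
- split; first by apply/subsetP => p /setIdP[].
  move=> p q /setIdP[pW npb] qW qp; rewrite inE qW; apply: contra npb.
  case/asboolP => x [y [lad yq]]; apply/asboolP; exists x, y; split=> //.
  exact: lt_le_trans qp.
- have DW : D \subset W by apply/subsetP => p /setIdP[].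
  move=> Y wallY; apply: (ladder_free_wall colP (m := m.+1) _ w0 wl _ wallY) => //.
    exact: width_leS wW.
  move=> x y lad.
  (* The last element [y m] of a ladder of size [m.+1] lies above the ladder formed by the other
     rungs. *)
  have lad' : ladder W m x y.
    move=> i im; have [xi yi h] := lad i (leqW im); split; rewrite ?(subsetP DW) //.
    by move=> j jm; apply: h; apply: leqW.
  have pm : (m.-1 < m.+1)%N by lia.
  have [_ ym _] := lad m (leqnn _); have [_ _ hy] := lad m.-1 pm.
  have [_ hyy _ _] := hy m (leqnn _); have [_ _ hy'] := lad m (leqnn _).
  have [_ hyy' _ _] := hy' m.-1 pm.
  move: ym; rewrite inE => /andP[_ /asboolPn[]]; exists x, y; split=> //.
  by rewrite lt_leAnge hyy hyy' leq_pred /= -ltnNge prednK.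
- have DW : W :\: D \subset W by apply: subsetDl.
  have inWD p : p \in W :\: D -> below p.
    by case/setDP=> pW; rewrite inE pW /= negbK => /asboolP.
  move=> Y wallY; apply: (IH _ _ ms0 _ wallY); first exact: width_leS wW.
  (* The least element of the next ladder, or the final point if no ladder is left, lies above some
     [m]-ladder, and so does all that follows. *)
  move=> hs; apply: nohs; case: ms hs ms0 {IH} => [|m2 ms] /=.
    case=> p pWD _; have [x [y [lad yp]]] := inWD p pWD; exists x, y; split=> //.
    by exists p; rewrite inE yp (subsetP DW).
  case=> x2 [y2 [lad2 hs]] /andP[m20 _].
  have [x20 _ xy20] := lad2 0 m20.
  have [x [y [lad yx2]]] := inWD _ x20; exists x, y; split=> //.
  exists x2, y2; split.
    move=> i im; have [xi yi h] := lad2 i im; have [hx _ hy _] := xy20 i im.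
    split=> //; rewrite inE (subsetP DW) //=; apply: lt_le_trans yx2 _.
      by rewrite hx.
    by rewrite hy.
  apply: has_seriesS hs; apply/subsetP => p /setIdP[pW yp].
  rewrite !inE (subsetP DW _ pW) yp andbT /=.
  apply: lt_trans yp; have pm : (m2.-1 < m2)%N by lia.
  by have [_ _ hy _] := xy20 _ pm; apply: lt_le_trans yx2 _; rewrite hy.
Qed.
End SeriesWall.

(** * First-Fit produces walls *)

Section FirstFit.
Variables (d : Order.disp_t) (P : finPOrderType d).
Implicit Types (C : {set P}) (Cs : seq {set P}) (s : seq P) (x y z : P).

Lemma chainP C : reflect {in C &, forall x y, x >=< y} (is_chain C).
Proof.
apply: (iffP forall_inP) => [chC x y xC yC|chC x xC].
  by have /forall_inP/(_ _ yC) := chC _ xC.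
by apply/forall_inP => y yC; apply: chC.
Qed.

Fixpoint greedy Cs : Prop :=
  if Cs is C :: Cs' then
    [/\ is_chain C, C != set0, greedy Cs' &
        forall C' x, C' \in Cs' -> x \in C' -> exists2 y, y \in C & x >< y]
  else True.

Lemma mem_ff_insert Cs x C z : C \in ff_insert Cs x -> z \in C ->
  z = x \/ exists2 C', C' \in Cs & z \in C'.
Proof.
elim: Cs => [|C0 Cs IH] /=; first by rewrite inE => /eqP-> /set1P; left.
case: ifP => _; rewrite inE => /orP[/eqP->|CCs] zC.
- case/setU1P: zC => [|zC]; [by left|right].
  by exists C0; rewrite ?inE ?eqxx.
- by right; exists C; rewrite ?inE ?CCs ?orbT.
- by right; exists C0; rewrite ?inE ?eqxx.
- have [|[C' C'Cs zC']] := IH CCs zC; [by left|right].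
  by exists C'; rewrite ?inE ?C'Cs ?orbT.
Qed.

Lemma cover_ff_insert Cs x z : z = x \/ (exists2 C, C \in Cs & z \in C) ->
  exists2 C, C \in ff_insert Cs x & z \in C.
Proof.
elim: Cs => [|C0 Cs IH] /=.
  case=> [->|[C]//]; exists [set x]%SET; by rewrite ?inE.
case: ifP => _ zP.
  case: zP => [->|[C]]; first by exists (x |: C0); rewrite !inE eqxx.
  rewrite inE => /orP[/eqP-> zC|CCs zC].
    by exists (x |: C0); rewrite !inE ?eqxx // zC orbT.
  by exists C; rewrite // inE CCs orbT.
suff [zC0|[C CCs zC]] : z \in C0 \/ exists2 C, C \in ff_insert Cs x & z \in C.
- by exists C0; rewrite // inE eqxx.
- by exists C; rewrite // inE CCs orbT.
case: zP => [zx|[C]]; first by right; apply: IH; left.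
rewrite inE => /orP[/eqP-> zC|CCs zC]; [by left|right].
by apply: IH; right; exists C.
Qed.

(** Chains only grow, so old witnesses persist; the new element passes over a chain only if some
    element of it is incomparable to it. *)
Lemma greedy_ff_insert Cs x : greedy Cs -> greedy (ff_insert Cs x).
Proof.
elim: Cs => [_|C0 Cs IH] /=.
  split=> //; first by apply/chainP => y z /set1P-> /set1P->; rewrite comparablexx.
  by apply/set0Pn; exists x; rewrite inE.
case=> chC0 neC0 gCs wit; case: ifP => [chx|nchx] /=.
  split=> //; first by apply/set0Pn; exists x; rewrite !inE eqxx.
  move=> C' y C'Cs yC'; have [z zC0 yz] := wit C' y C'Cs yC'.
  by exists z; rewrite // !inE zC0 orbT.
split=> //; first exact: IH.
move=> C' z C'ins zC'; have [zx|[C CCs zC]] := mem_ff_insert C'ins zC'; last first.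
  exact: wit zC.
case: (pickP [pred y in C0 | z >< y]) => [y /andP[yC0 zy]|noy]; first by exists y.
have cz y : y \in C0 -> z >=< y.
  by move=> yC0; have := noy y; rewrite inE /= yC0 /= => /negbFE.
case/negP: nchx; apply/chainP => u v /setU1P[->|uC] /setU1P[->|vC].
- exact: comparablexx.
- by rewrite -zx cz.
- by rewrite -zx comparable_sym cz.
- by move/chainP: chC0; apply.
Qed.

Lemma first_fit_greedy s : greedy (first_fit s).
Proof.
rewrite /first_fit; have : greedy [::] by [].
elim: s [::] => [|x s IH] Cs //= gCs; apply: IH; exact: greedy_ff_insert.
Qed.

Lemma first_fit_cover s x : x \in s -> exists2 C, C \in first_fit s & x \in C.
Proof.
rewrite /first_fit => xs.
suff gen Cs : x \in s \/ (exists2 C, C \in Cs & x \in C) ->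
    exists2 C, C \in foldl (@ff_insert d P) Cs s & x \in C by apply: gen; left.
elim: s Cs {xs} => [|y s IH] Cs /=; first by case.
move=> xP; apply: IH; case: xP => [|xCs]; last by right; apply: cover_ff_insert; right.
by rewrite inE => /orP[/eqP->|]; [right; apply: cover_ff_insert; left|left].
Qed.

Lemma greedy_nth Cs : greedy Cs -> forall i, (i < size Cs)%N ->
  [/\ is_chain (nth set0 Cs i), nth set0 Cs i != set0 &
   forall j x, (j < i)%N -> x \in nth set0 Cs i ->
     exists2 y, y \in nth set0 Cs j & x >< y].
Proof.
elim: Cs => [|C Cs IH] //= [chC neC gCs wit] [_|i iCs]; first by split.
have [chi nei witi] := IH gCs i iCs; split=> // -[|j] x /= ji xi; last exact: witi.
by apply: wit xi; apply: mem_nth.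
Qed.

(** The colour is the index of the chain. The additional colour, outside the wall, keeps the type of
    colours inhabited when there is no chain. *)
Lemma first_fit_wall s : (forall x, x \in s) ->
  exists col : P -> 'I_(size (first_fit s)).+1,
    (forall x y, col x = col y -> x >=< y) /\
    wall col [set: P]%SET [set c : 'I_(size (first_fit s)).+1 | (c < size (first_fit s))%N]%SET.
Proof.
move=> sP; set Cs := first_fit s; have gCs := greedy_nth (first_fit_greedy s).
pose ix x := find (fun C : {set P} => x \in C) Cs.
have ixlt x : (ix x < size Cs)%N.
  have [C CCs xC] := first_fit_cover (sP x).
  by rewrite -has_find; apply/hasP; exists C.
have ixP x : x \in nth set0 Cs (ix x).
  by apply: (nth_find set0 (a := fun C : {set P} => x \in C)); rewrite has_find ixlt.
(* The chains are disjoint: an element of two of them would have an incomparable element in the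
   earlier one. *)
have ixE i x : (i < size Cs)%N -> x \in nth set0 Cs i -> ix x = i.
  move=> iCs xi; have [ii|ii|//] := ltngtP (ix x) i.
    have [_ _ wit] := gCs i iCs; have [y yj xy] := wit _ _ ii xi.
    have [/chainP ch _ _] := gCs _ (ixlt x).
    by case/negP: xy; apply: ch.
  have [_ _ wit] := gCs _ (ixlt x); have [y yj xy] := wit _ _ ii (ixP x).
  have [/chainP ch _ _] := gCs _ iCs.
  by case/negP: xy; apply: ch.
pose col x : 'I_(size Cs).+1 := inord (ix x).
have colE x : col x = ix x :> nat by rewrite inordK // ltnS ltnW.
exists col; split=> [x y xy|].
  have ixy : ix x = ix y by rewrite -!colE xy.
  have [/chainP ch _ _] := gCs _ (ixlt x).
  by apply: ch; rewrite ?ixP // ixy ixP.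
split=> [c|x b _ _].
  rewrite inE => cCs; have [_ /set0Pn[x xc] _] := gCs _ cCs.
  by exists x; rewrite ?inE //; apply: val_inj; rewrite /= colE (ixE c).
rewrite inE colE => bCs bx; have [_ _ wit] := gCs _ (ixlt x).
have [y yb xy] := wit _ _ bx (ixP x); exists y; split; rewrite ?inE //.
by apply: val_inj; rewrite /= colE (ixE b).
Qed.

End FirstFit.

(** * Series compositions of ladder-like posets *)

(** The tail [ms'] that survives above the image allows embeddings to be stacked. *)
Definition embeds_in_series (d : Order.disp_t) (Q : finPOrderType d) (ms : seq nat) :=
  forall (d' : Order.disp_t) (P : finPOrderType d') (W : {set P}) (ms' : seq nat),
    has_series W (ms ++ ms') ->
    exists f : Q -> P, [/\ forall q, f q \in W, {mono f : x y / x <= y} &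
      has_series [set p in W | [forall q, f q < p]]%SET ms'].

(** The bound on [sumn ms] is what makes the final constant linear in the size of [Q]. *)
Definition ladder_embeddable (d : Order.disp_t) (Q : finPOrderType d) :=
  exists ms : seq nat,
    [/\ all (fun m => 0 < m)%N ms, (sumn ms <= #|Q|)%N & embeds_in_series Q ms].

(** One ladder with [#|Q|] rungs suffices: [C1] goes to the lower rail and [C2] to the upper one, at
    positions chosen so that [al u <= be v] exactly when [u <= v]. *)
Lemma ladder_like_embeddable (d : Order.disp_t) (Q : finPOrderType d) :
  ladder_like Q -> ladder_embeddable Q.
Proof.
case=> C1 [C2 [C12 /pred0P dis /chainP ch1 /chainP ch2 lt12]].
(* Ladder sizes have to be positive, so the empty poset takes the empty list. *)
have [Q0|Q0] := posnP #|Q|.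
  exists [::]; split=> // d' P W ms' hs.
  have q0 (q : Q) : False by have := card0_eq Q0 q.
  exists (fun q => False_rect _ (q0 q)); split=> [q|q|]; try by case: (q0 q).
  apply: has_seriesS hs; apply/subsetP => p pW; rewrite inE pW /=.
  by apply/forallP => q; case: (q0 q).
have inC2 q : (q \in C2) = (q \notin C1).
  have := dis q; have : q \in C1 :|: C2 by rewrite C12 inE.
  by rewrite inE /=; case: (q \in C1); case: (q \in C2).
(* Positions in the linear order in which an element of [C2] precedes the
   elements of [C1] it is incomparable to. *)
pose al (u : Q) := #|[set z | if z \in C1 then z < u else ~~ (u < z)]%SET|.
pose be (v : Q) := #|[set z | z < v]%SET|.
exists [:: #|Q|]; split; rewrite /= ?Q0 ?addn0 // => d' P W ms' /= [x [y [lad hs]]].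
have alQ u : u \in C1 -> (al u < #|Q|)%N.
  move=> uC; rewrite -cardsT; apply: proper_card; apply/properP.
  by split; [exact: subsetT|exists u; rewrite !inE // uC ltxx].
have beQ v : (be v < #|Q|)%N.
  rewrite -cardsT; apply: proper_card; apply/properP.
  by split; [exact: subsetT|exists v; rewrite !inE // ltxx].
have al_be u v : u \in C1 -> v \in C2 -> (al u <= be v)%N = (u <= v).
  move=> uC vC.
  have [uv|] := boolP (u < v); last first.
    move=> nuv; have -> : (u <= v) = false.
      by apply/negP => uv; case/negP: nuv; apply: lt12; rewrite ?le_comparable.
    apply/negbTE; rewrite -ltnNge; apply: proper_card; apply/properP; split.
      apply/subsetP => z; rewrite !inE => zv; case: ifPn => zC.
        have := ch1 _ _ zC uC; case: comparableP => // [uz|uz] _.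
          by case/negP: nuv; apply: lt_trans zv.
        by case/negP: nuv; rewrite -uz in zv *.
      by apply: contra nuv => uz; apply: lt_trans zv.
    by exists v; rewrite !inE ?ltxx // -[_ \in C1]negbK -inC2 vC.
  rewrite ltW //; apply: subset_leq_card; apply/subsetP => z; rewrite !inE.
  case: ifPn => [_ zu|zC nuz]; first exact: lt_trans uv.
  rewrite -inC2 in zC; have := ch2 _ _ zC vC; case: comparableP => // [vz|vz] _.
    by case/negP: nuz; apply: lt_trans vz.
  by case/negP: nuz; rewrite vz.
have al_lt u u' : u \in C1 -> u < u' -> (al u < al u')%N.
  move=> uC uu'; apply: proper_card; apply/properP; split.
    apply/subsetP => z; rewrite !inE; case: ifP => _; first by move=> /lt_trans->.
    by apply: contra; apply: lt_trans.
  by exists u; rewrite !inE uC ?ltxx.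
have be_lt v v' : v < v' -> (be v < be v')%N.
  move=> vv'; apply: proper_card; apply/properP; split.
    by apply/subsetP => z; rewrite !inE => /lt_trans->.
  by exists v; rewrite !inE ?ltxx.
pose f q := if q \in C1 then x (al q) else y (be q).
exists f; split.
- move=> q; rewrite /f; case: ifPn => qC; first by have [] := lad _ (alQ _ qC).
  by have [] := lad _ (beQ q).
- move=> q r; rewrite /f; case: ifPn => qC; case: ifPn => rC.
  + have [_ _ /(_ _ (alQ _ rC))[-> _ _ _]] := lad _ (alQ _ qC).
    have := ch1 _ _ qC rC; case: comparableP => // [qr|rq|->] _.
    * by rewrite ltnW ?al_lt.
    * by rewrite leqNgt al_lt.
    * by rewrite leqnn.
  + have [_ _ /(_ _ (beQ r))[_ _ -> _]] := lad _ (alQ _ qC).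
    by rewrite al_be ?inC2.
  + have [_ _ /(_ _ (alQ _ rC))[_ _ _ ->]] := lad _ (beQ q).
    apply/esym/negbTE/negP => qr.
    have rq : r < q by apply: lt12; rewrite ?inC2 // comparable_sym le_comparable.
    by have := lt_le_trans rq qr; rewrite ltxx.
  + have [_ _ /(_ _ (beQ r))[_ -> _ _]] := lad _ (beQ q).
    have := ch2 q r; rewrite !inC2 => /(_ qC rC); case: comparableP => // [qr|rq|->] _.
    * by rewrite ltnW ?be_lt.
    * by rewrite leqNgt be_lt.
    * by rewrite leqnn.
- apply: has_seriesS hs; apply/subsetP => p /setIdP[pW yp].
  rewrite inE pW; apply/forallP => q; apply: le_lt_trans yp.
  have pm : (#|Q|.-1 < #|Q|)%N by lia.
  rewrite /f; case: ifPn => qC.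
    have [_ _ /(_ _ pm)[_ _ -> _]] := lad _ (alQ _ qC).
    by have := alQ _ qC; lia.
  have [_ _ /(_ _ pm)[_ -> _ _]] := lad _ (beQ q).
  by have := beQ q; lia.
Qed.

Lemma iso_embeddable (d d' : Order.disp_t) (Q : finPOrderType d)
    (Q' : finPOrderType d') :
  poset_iso Q Q' -> ladder_embeddable Q -> ladder_embeddable Q'.
Proof.
case=> h hbij hmono [ms [ms0 sms emb]].
have [h' hK h'K] := hbij.
exists ms; split=> //; first by rewrite -(bij_eq_card hbij).
move=> d1 P W ms' /emb[f [fW fmono fhs]]; exists (f \o h'); split=> [q|q r|] /=.
- exact: fW.
- by rewrite fmono -hmono !h'K.
- apply: has_seriesS fhs; apply/subsetP => p /setIdP[pW /forallP fp].
  by rewrite inE pW; apply/forallP => q /=; apply: fp.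
Qed.

Lemma has_series_inhabited (d : Order.disp_t) (P : finPOrderType d) (W : {set P}) ms :
  has_series W ms -> exists p : P, True.
Proof. by case: ms => [[p _]|m ms /= [x _]]; [exists p|exists (x 0)]. Qed.

Section Series.
Variables (d : Order.disp_t) (n : nat) (S : 'I_n -> finPOrderType d).
Variables (d' : Order.disp_t) (P : finPOrderType d').

(** The transport along [e] is forced by the dependence of the domain [S j] on the index. *)
Definition update_family (f : forall i, S i -> P) (i : 'I_n) (g : S i -> P) :
    forall j, S j -> P :=
  fun j => if eqP is ReflectT e in reflect _ b return S j -> P
           then eq_rect i (fun k => S k -> P) g j e else f j.

Lemma update_family_same f i (g : S i -> P) : @update_family f i g i = g.
Proof.
rewrite /update_family; case: eqP => // e.
by rewrite (eq_axiomK e).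
Qed.

Lemma update_family_diff f i (g : S i -> P) j : i != j -> @update_family f i g j = f j.
Proof. by rewrite /update_family; case: eqP. Qed.

(** The first block is embedded, and the later blocks are placed in the part of [W] above its
    image. *)
Lemma embed_blocks (ms : 'I_n -> seq nat) (L : seq 'I_n) (W : {set P}) (ms' : seq nat) :
    (forall i, embeds_in_series (S i) (ms i)) ->
    pairwise (fun i j : 'I_n => (i < j)%N) L ->
    has_series W (flatten [seq ms i | i <- L] ++ ms') ->
  exists f : forall i, S i -> P,
    [/\ forall i, i \in L -> forall q, f i q \in W,
        forall i, i \in L -> {mono f i : x y / x <= y},
        forall i j, i \in L -> j \in L -> (i < j)%N -> forall q r, f i q < f j r &
        has_series [set p in W | [forall i, (i \in L) ==> [forall q, f i q < p]]]%SET ms'].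
Proof.
move=> emb; elim: L W => [|i L IH] W /=.
  move=> _ hs; have [p _] := has_series_inhabited hs.
  exists (fun _ _ => p); split=> //; apply: has_seriesS hs.
  by apply/subsetP => q qW; rewrite inE qW; apply/forallP.
case/andP=> /allP iL pwL; rewrite -catA => /emb[g [gW gmono /(IH _ pwL)]].
case=> f [fW fmono flt fhs]; have neL j : j \in L -> i != j.
  by move=> /iL ij; apply: contraTneq ij => ->; rewrite ltnn.
exists (update_family f g); split.
- move=> j; rewrite inE => /orP[/eqP->|jL] q; first by rewrite update_family_same.
  by rewrite update_family_diff ?neL //; have /setIdP[] := fW _ jL q.
- move=> j; rewrite inE => /orP[/eqP->|jL]; first by rewrite update_family_same.
  by rewrite update_family_diff ?neL //; apply: fmono.
- move=> j k; rewrite !inE => /orP[/eqP->|jL] /orP[/eqP->|kL] jk q r.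
  + by rewrite ltnn in jk.
  + rewrite update_family_same update_family_diff ?neL //.
    by have /setIdP[_ /forallP] := fW _ kL r.
  + by have := ltn_trans jk (iL _ jL); rewrite ltnn.
  + by rewrite !update_family_diff ?neL //; apply: flt.
- apply: has_seriesS fhs; apply/subsetP => p /setIdP[/setIdP[pW /forallP gp]].
  move=> /forallP fp; rewrite inE pW; apply/forallP => j; apply/implyP.
  rewrite inE => /orP[/eqP->|jL]; apply/forallP => q.
    by rewrite update_family_same.
  rewrite update_family_diff ?neL //; have := fp j; rewrite jL => /forallP; exact.
Qed.
End Series.

Lemma series_embeddable (d : Order.disp_t) (n : nat) (S : 'I_n -> finPOrderType d) :
  (forall i, ladder_embeddable (S i)) -> ladder_embeddable (series_comp S).
Proof.
move/fin_all_exists => [ms msP].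
have pwI : pairwise (fun i j : 'I_n => (i < j)%N) (enum 'I_n).
  by have := iota_ltn_sorted 0 n; rewrite sorted_pairwise -?val_enum_ord ?pairwise_map //;
     apply: ltn_trans.
exists (flatten [seq ms i | i <- enum 'I_n]); split.
- apply/allP => m /flattenP[s /mapP[i _ ->]]; have [/allP h _ _] := msP i; exact: h.
- rewrite sumn_flatten -map_comp card_tagged.
  rewrite !sumnE !big_map; apply: leq_sum => i _; by have [] := msP i.
move=> d' P W ms' hs; have emb i : embeds_in_series (S i) (ms i) by have [] := msP i.
have [f [fW fmono flt fhs]] := embed_blocks emb pwI hs.
have inI i : i \in enum 'I_n by rewrite mem_enum.
exists (fun z => f (tag z) (tagged z)); split=> [q|[i q] [j r]|] /=.
- by apply: fW; rewrite inI.
- rewrite leEsig /=; have [ij|ji|ij] := ltngtP i j.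
  + by rewrite !leEord ltnW // leqNgt ij /= ltW // flt ?inI.
  + by rewrite leEord leqNgt ji /= lt_geF // flt ?inI.
  + have {}ij := val_inj ij; case: _ / ij r => r.
    by rewrite fmono ?inI // lexx tagged_asE.
- apply: has_seriesS fhs; apply/subsetP => p /setIdP[pW /forallP fp].
  rewrite inE pW; apply/forallP => -[i q] /=; have := fp i; rewrite inI => /forallP.
  exact.
Qed.

Lemma series_ladder_embeddable (d : Order.disp_t) (Q : finPOrderType d) :
  series_ladder Q -> ladder_embeddable Q.
Proof.
elim=> {d Q} [d Q|d n S _|d d' Q Q' iso _]; first exact: ladder_like_embeddable.
  exact: series_embeddable.
exact: iso_embeddable.
Qed.

Lemma series_ladder_avoid (d d' : Order.disp_t) (Q : finPOrderType d)
    (P : finPOrderType d') : series_ladder Q -> poset_free Q P ->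
  exists ms : seq nat, [/\ all (fun m => 0 < m)%N ms, (sumn ms <= #|Q|)%N &
    ~ has_series [set: P]%SET ms].
Proof.
move=> /series_ladder_embeddable[ms [ms0 sms emb]] freeQ; exists ms; split=> // hs.
apply: freeQ; have := emb _ P [set: P]%SET [::]; rewrite cats0 => /(_ hs)[f [_ fmono _]].
by exists f.
Qed.

(** * Upper bound *)

Lemma width_leT (d : Order.disp_t) (P : finPOrderType d) :
  width_le [set: P]%SET (width P).
Proof. by move=> A _ acA; rewrite /width (bigD1 A) //= leq_maxl. Qed.

(** For [w = 1] the logarithm vanishes and the claimed bound is 1, so this case is treated apart: a
    second chain would give two incomparable elements. *)
Lemma width1_first_fit (d : Order.disp_t) (P : finPOrderType d) (s : seq P) :
  width P = 1%N -> (forall x, x \in s) -> (size (first_fit s) <= 1)%N.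
Proof.
move=> w1 sP; have [col [colP [ne wit]]] := first_fit_wall sP.
rewrite leqNgt; apply/negP => lt1.
have lt1' : (1 < (size (first_fit s)).+1)%N by apply: ltnW.
have [|x _ xc] := ne (Ordinal lt1'); first by rewrite inE.
have := wit x ord0 (in_setT x); rewrite xc !inE => /(_ lt1 (ltnW lt1) isT)[y [_ _ xy]].
have := @width_leT _ P [set x; y]%SET (subsetT _).
rewrite w1 cards2; case: eqVneq xy => [->|_ xy]; first by rewrite comparablexx.
suff /[swap]/[apply] : is_antichain [set x; y]%SET by [].
apply/antichainP => u v /set2P[->|->] /set2P[->|->] //; first by rewrite (negbTE xy).
by rewrite comparable_sym (negbTE xy).
Qed.

(** With [w] and [w.+1] at most [2 ^ l] and [m.+1] at most [2 ^ m], the exponents add up to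
    [6 * l + 2 * m + 1]. *)
Lemma ladder_base_le (w l m : nat) : (0 < l)%N -> (w < 2 ^ l)%N ->
  (ladder_base w m.+1 <= 2 ^ (7 * l + 2 * m))%N.
Proof.
move=> l0 wl; have m1 : (m.+1 <= 2 ^ m)%N by apply: ltn_expl.
have wl' := ltnW wl.
pose X := (w.+1 ^ 2 * (w * m.+1 * (w * m.+1)) * w)%N.
have XX : (X <= (2 ^ l) ^ 2 * (2 ^ l * 2 ^ m * (2 ^ l * 2 ^ m)) * 2 ^ l)%N.
  by rewrite /X !leq_mul // leq_exp2r.
have step : (ladder_base w m.+1 <= 2 ^ l * (2 * ((2 ^ l) ^ 2 *
    (2 ^ l * 2 ^ m * (2 ^ l * 2 ^ m)) * 2 ^ l)))%N.
  rewrite /ladder_base /ladder_factor -/X leq_mul //.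
  apply: leq_trans (_ : 1 + ((2 ^ l) ^ 2 * (2 ^ l * 2 ^ m * (2 ^ l * 2 ^ m)) * 2 ^ l) <= _)%N.
    by rewrite leq_add2l.
  rewrite mul2n -addnn leq_add2r !muln_gt0 !expn_gt0 //.
apply: leq_trans step _.
rewrite -!expnM -!expnD -expnS -expnD leq_exp2l //; lia.
Qed.

(** The added 1 on the left carries the induction: [(g + 1) * (sb + 1) + 1 <= (g + 2) * (sb + 1)],
    and [g + 2] costs two more binary digits than the bound on [g]. *)
Lemma series_bound_le (w l : nat) (ms : seq nat) : (0 < l)%N -> (w < 2 ^ l)%N ->
  (series_bound (fun m => ladder_base w m ^ l)%N ms + 1 <=
   2 ^ ((7 * l ^ 2 + 2) * size ms + 2 * l * sumn ms))%N.
Proof.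
move=> l0 wl; elim: ms => [|m ms IH] //=; first by rewrite !muln0.
set sb := series_bound _ ms in IH *; set E := (_ * size ms + _)%N in IH.
have gle : (ladder_base w m.+1 ^ l <= 2 ^ (7 * l ^ 2 + 2 * l * m))%N.
  have -> : (7 * l ^ 2 + 2 * l * m = (7 * l + 2 * m) * l)%N.
    by rewrite -mulnn mulnDl mulnA [(2 * l * m)%N]mulnAC.
  by rewrite expnM leq_exp2r // ladder_base_le.
have -> : ((7 * l ^ 2 + 2) * (size ms).+1 + 2 * l * (m + sumn ms) =
   (7 * l ^ 2 + 2 * l * m + 2) + E)%N.
  by rewrite /E mulnS mulnDr; lia.
rewrite (expnD _ _ E) (expnD _ _ 2).
apply: leq_trans (_ : (ladder_base w m.+1 ^ l + 2) * (sb + 1) <= _)%N.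
  by move: (_ ^ l)%N => g; nia.
apply: leq_mul => //; move: gle; have : (0 < 2 ^ (7 * l ^ 2 + 2 * l * m))%N by rewrite expn_gt0.
by move: (2 ^ _)%N (ladder_base _ _ ^ l)%N => a b; lia.
Qed.

Lemma first_fit_le (d d' : Order.disp_t) (Q : finPOrderType d) (P : finPOrderType d')
    (s : seq P) (l : nat) :
  series_ladder Q -> poset_free Q P -> (forall x, x \in s) ->
  (0 < width P)%N -> (0 < l)%N -> (width P < 2 ^ l)%N ->
  (size (first_fit s) <= 2 ^ (11 * l ^ 2 * #|Q|))%N.
Proof.
move=> /series_ladder_avoid/[apply] -[ms [ms0 sms nohs]] sP w0 l0 wl.
have [col [colP wallP]] := first_fit_wall sP.
have := series_free_wall colP ms0 w0 wl (@width_leT _ P) wallP nohs.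
have -> : #|[set c : 'I_(size (first_fit s)).+1 | (c < size (first_fit s))%N]%SET| =
    size (first_fit s).
  rewrite -[RHS](card_ord (size (first_fit s)).+1.-1) -pred_Sn.
  have -> : [set c : 'I_(size (first_fit s)).+1 | (c < size (first_fit s))%N]%SET =
      [set~ ord_max]%SET.
    by apply/setP => c; rewrite !inE -val_eqE /= ltn_neqAle -ltnS ltn_ord andbT.
  by rewrite cardsC1 !card_ord.
move=> sizele; have := series_bound_le ms l0 wl.
have sizems : (size ms <= sumn ms)%N.
  elim: (ms) ms0 {sms nohs sizele} => //= m ms1 IH /andP[m0 /IH]; lia.
move=> bound; apply: leq_trans sizele _; apply: leq_trans (leq_addr 1 _) _.
apply: leq_trans bound _; rewrite leq_exp2l //.
(* The constant is 11 = 7 + 2 + 2, as [size ms] and [sumn ms] are at most [#|Q|] and [l] is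
   positive. *)
have := leq_trans sizems sms; nia.
Qed.

(** * Lower bound *)

Definition subposet_on (d : Order.disp_t) (P : finPOrderType d) (V : pred P) : Type :=
  {x : P | V x}.

HB.instance Definition _ (d : Order.disp_t) (P : finPOrderType d) (V : pred P) :=
  SubFinite.on (subposet_on V).
HB.instance Definition _ (d : Order.disp_t) (P : finPOrderType d) (V : pred P) :=
  [SubChoice_isSubPOrder of subposet_on V by <: with d].

Lemma le_subposet_on (d : Order.disp_t) (P : finPOrderType d) (V : pred P)
  (x y : subposet_on V) : (x <= y) = (val x <= val y).
Proof. by []. Qed.

(** The map [r] exhibits [Q] as the series composition of its fibres, some of which may be empty. *)
Lemma series_ladder_fibers (d : Order.disp_t) (Q : finPOrderType d) (n : nat)
    (r : Q -> 'I_n) :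
    (forall x y, (r x < r y)%N -> x < y) ->
    (forall i, series_ladder (subposet_on (fun x => r x == i))) ->
  series_ladder Q.
Proof.
move=> rlt fib; pose S i : finPOrderType d := subposet_on (fun x => r x == i).
apply: (series_ladder_iso (P := series_comp S)); last exact: series_ladder_series.
pose f (z : {i : 'I_n & S i}) : Q := val (tagged z).
pose g (x : Q) : {i : 'I_n & S i} := Tagged S (exist (fun y => r y == r x) x (eqxx _)).
have rf z : r (f z) = tag z by case: z => i [x xi]; apply/eqP.
exists f.
  exists g => [[i [x xi]]|x] //.
  rewrite /g /f /=; move/eqP: (xi) => ri; subst i.
  by congr (Tagged S _); apply: val_inj.
move=> [i x] [j y]; rewrite /f /= leEsig /= !leEord.
have ri : r (val x) = i by apply/eqP/(valP x).
have rj : r (val y) = j by apply/eqP/(valP y).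
have [ij|ji|ij] := ltngtP i j.
- by rewrite ltW // rlt // ri rj.
- by rewrite lt_geF // rlt // ri rj.
- by have {}ij := val_inj ij; case: _ / ij y rj => y _; rewrite tagged_asE.
Qed.

Lemma width_sub (d d' : Order.disp_t) (P : finPOrderType d) (Q : finPOrderType d')
    (f : Q -> P) : {mono f : x y / x <= y} -> (width Q <= width P)%N.
Proof.
move=> fmono; have finj : injective f.
  by move=> x y fxy; apply: le_anti; rewrite -!fmono fxy lexx.
apply/bigmax_leqP => A /antichainP acA; rewrite -(card_imset _ finj).
apply: width_leT; first exact: subsetT.
apply/antichainP => _ _ /imsetP[x xA ->] /imsetP[y yA ->] xy; congr f.
by apply: acA => //; move: xy; rewrite /Order.comparable !fmono.
Qed.

(** * A poset with one more unit of width and twice as many colours plus one *)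

Section Step.
Variables (d : Order.disp_t) (T : finPOrderType d) (M : nat).

(* Blocks [A_0 < ... < A_M.+1], each carved from a copy of [T], beside a chain
   [d_0 < ... < d_M]; the only relations between the two parts are [A_i < d_k]
   for [i < k]. *)
Definition comb : Type := ('I_M.+2 * T + 'I_M.+1)%type.

HB.instance Definition _ := Finite.on comb.

Definition comb_le (u v : comb) : bool :=
  match u, v with
  | inl (i, x), inl (j, y) => (i < j)%N || (i == j) && (x <= y)
  | inl (i, _), inr k => (i < k)%N
  | inr _, inl _ => false
  | inr k, inr l => (k <= l)%N
  end.

Lemma comb_le_refl : reflexive comb_le.
Proof. by case=> [[i x]|k] /=; rewrite ?eqxx ?lexx ?orbT. Qed.

Lemma comb_le_anti : antisymmetric comb_le.
Proof.
case=> [[i x]|k] [[j y]|l] //=; rewrite ?andbF //.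
  have [ij|ji|/val_inj->] := ltngtP i j; rewrite ?andbF //= ?eqxx /=.
  - by rewrite -val_eqE (gtn_eqF ij).
  - by rewrite -val_eqE (gtn_eqF ji).
  - by move=> /le_anti->.
by rewrite -eqn_leq => /eqP/val_inj->.
Qed.

Lemma comb_le_trans : transitive comb_le.
Proof.
case=> [[j y]|l] [[i x]|k] [[h z]|t] //=.
- move=> /orP[ij|/andP[/eqP-> xy]] /orP[jh|/andP[/eqP<- yz]].
  + by rewrite (ltn_trans ij).
  + by rewrite ij.
  + by rewrite jh.
  + by rewrite eqxx (le_trans xy) // orbT.
- by case/orP=> [ij|/andP[/eqP-> _]] // /(ltn_trans ij).
- by move=> il lt; apply: leq_trans lt.
- exact: leq_trans.
Qed.

HB.instance Definition _ :=
  Order.Le_isPOrder.Build d comb comb_le_refl comb_le_anti comb_le_trans.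

Lemma comb_leE (u v : comb) : (u <= v) = comb_le u v.
Proof. by []. Qed.

End Step.

(** The invariant of the recursive construction. The poset is the part of [T] cut out by [V], which
    keeps the next carrier a plain sum type; [tower_sub] will make it [Q]-free. *)
Record tower (w M : nat) (d : Order.disp_t) (T : finPOrderType d) (V : pred T)
    (col : T -> nat) : Prop := {
  tower_col : forall x, V x -> (col x < M)%N;
  tower_ne : forall c, (c < M)%N -> exists2 x, V x & col x = c;
  tower_chain : forall x y, V x -> V y -> col x = col y -> x >=< y;
  tower_wit : forall x c, V x -> (c < col x)%N ->
    exists y, [/\ V y, col y = c & x >< y];
  tower_width : forall A : {set T}, (forall x, x \in A -> V x) ->
    is_antichain A -> (#|A| <= w)%N;
  tower_antichain : exists A : {set T},
    [/\ forall x, x \in A -> V x, is_antichain A & #|A| = w];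
  tower_sub : forall (d' : Order.disp_t) (Q : finPOrderType d') (f : Q -> T),
    (forall q, V (f q)) -> {mono f : x y / x <= y} -> (width Q <= 2)%N ->
    series_ladder Q }.

Lemma tower1 : tower 1 1 (T := 'I_1) predT (fun=> 0).
Proof.
split=> //.
- by move=> [|c] // _; exists ord0.
- by move=> A _ _; apply: leq_trans (max_card _) _; rewrite card_ord.
- exists [set ord0]%SET; split=> //; last by rewrite cards1.
  by apply/antichainP => x y /set1P-> /set1P->.
- move=> d' Q f _ fmono _; apply: series_ladder_base.
  exists [set: Q]%SET, set0; split; rewrite ?setU0 //.
  + by rewrite disjoint_sym disjoints_subset sub0set.
  + by apply/chainP => x y _ _; rewrite /Order.comparable -!fmono [f x]ord1 [f y]ord1 lexx.
  + by apply/chainP => x y; rewrite inE.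
  + by move=> x y _; rewrite inE.
Qed.

Section TowerStep.
Variables (w M : nat) (d : Order.disp_t) (T : finPOrderType d) (V : pred T).
Variable (col : T -> nat).
Hypothesis towV : tower w M V col.

(* With [M] colours in [T], block [A_i] keeps the colours below [M - i] for
   [i <= M], the last block is a full copy of [T] with colours shifted by [M + 1],
   and [d_k] has colour [M - k]. This makes [2 M + 1] colours. *)
Definition comb_mem (u : comb T M) : bool :=
  match u with
  | inl (i, x) => V x && ((i == M.+1 :> nat) || (col x < M - i)%N)
  | inr _ => true
  end.

Definition comb_col (u : comb T M) : nat :=
  match u with
  | inl (i, x) => if i == M.+1 :> nat then (col x + M.+1)%N else col x
  | inr k => (M - k)%N
  end.

Lemma comb_comparable (u v : comb T M) : (u >=< v) = comb_le u v || comb_le v u.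
Proof. by []. Qed.

(** An antichain meets only one block, in at most [w] elements, and the chain beside the blocks in
    at most one. *)
Lemma comb_width (A : {set comb T M}) :
  (forall u, u \in A -> comb_mem u) -> is_antichain A -> (#|A| <= w.+1)%N.
Proof.
move=> AV /antichainP acA.
pose B := [set k | (inr k : comb T M) \in A]%SET.
have B1 : (#|B| <= 1)%N.
  apply/card_le1_eqP => k l; rewrite !inE => kA lA.
  have : (inr k : comb T M) = inr l; last by case.
  by apply: acA => //; rewrite comb_comparable /= leq_total.
pose iB := [set (inr k : comb T M) | k in B]%SET.
have iB1 : (#|iB| <= 1)%N by apply: leq_trans (leq_imset_card _ _) B1.
case: (pickP [pred u in A | if u is inl _ then true else false]) => [[[i x]|k]|none].
- rewrite inE /= andbT => ixA.
  pose C := [set y | (inl (i, y) : comb T M) \in A]%SET.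
  have Cw : (#|C| <= w)%N.
    apply: (tower_width towV); first by move=> y; rewrite inE => /AV /andP[].
    apply/antichainP => y z; rewrite !inE => yA zA yz.
    have : (inl (i, y) : comb T M) = inl (i, z); last by case.
    by apply: acA => //; rewrite comb_comparable /= eqxx ltnn.
  pose iC := [set (inl (i, y) : comb T M) | y in C]%SET.
  have iCw : (#|iC| <= w)%N by apply: leq_trans (leq_imset_card _ _) Cw.
  apply: leq_trans (_ : #|iC :|: iB| <= _)%N; last first.
    by apply: leq_trans (leq_card_setU _ _) _; rewrite -addn1 leq_add.
  apply/subset_leq_card/subsetP => -[[j y]|k] uA; rewrite inE.
    have ij : i = j.
      apply/eqP; case: (altP (i =P j)) => // ij.
      have : (inl (i, x) : comb T M) = inl (j, y); last by case=> e; rewrite e eqxx in ij.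
      apply: acA => //; rewrite comb_comparable /=.
      by move: ij; rewrite -val_eqE neq_ltn => /orP[->|->]; rewrite ?orbT.
    by apply/orP; left; apply/imsetP; exists y; rewrite ?inE ij.
  by apply/orP; right; apply/imsetP; exists k; rewrite ?inE.
- by rewrite inE /= andbF.
- apply: leq_trans (_ : #|iB| <= _)%N; last by apply: leq_trans iB1 _.
  apply/subset_leq_card/subsetP => -[[j y]|k] uA.
    by have := none (inl (j, y)); rewrite inE uA.
  by apply/imsetP; exists k; rewrite ?inE.
Qed.

Lemma comb_sub (d' : Order.disp_t) (Q : finPOrderType d') (f : Q -> comb T M) :
    (forall q, comb_mem (f q)) -> {mono f : x y / x <= y} -> (width Q <= 2)%N ->
  series_ladder Q.
Proof.
move=> fV fmono wQ.
(* Below the first [d_i0] in the image the blocks are in series; from there on,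
   width 2 forces the blocks to form a chain, so the rest is ladder-like. *)
have [i0 [i0M i0le i0ex]] : exists i0 : nat, [/\ (i0 < M.+3)%N,
    forall q k, f q = inr k -> (i0 <= k)%N &
    (i0 < M.+2)%N -> exists q k, f q = inr k /\ k = i0 :> nat].
  case: (pickP [pred k | [exists q, f q == inr k]]) => [k0 k0P|none]; last first.
    exists M.+2; split=> // [q k fqk|]; last by rewrite ltnn.
    by have := none k; rewrite /= => /existsP[]; exists q; apply/eqP.
  case: (arg_minnP (P := fun k => [exists q, f q == inr k]) val k0P) => k.
  case/existsP=> q /eqP fqk kmin; exists k; split.
  - by have := ltn_ord k; lia.
  - by move=> q' k' fq'; apply: kmin; apply/existsP; exists q'; apply/eqP.
  - by move=> _; exists q, k.
(* The blocks before [i0] stay separate layers, and all the rest is merged into one last layer. *)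
pose rk (u : comb T M) : nat := if u is inl (j, _) then minn j i0 else i0.
have rkM u : (rk u < M.+3)%N by case: u => [[j x]|k] //=; have := ltn_ord j; lia.
pose r q : 'I_M.+3 := inord (rk (f q)).
have rE q : r q = rk (f q) :> nat by rewrite inordK.
apply: (series_ladder_fibers (r := r)) => [p q|i].
  rewrite !rE lt_neqAle -fmono comb_leE -(inj_eq (f := f)); last first.
    by move=> x y fxy; apply: le_anti; rewrite -!fmono fxy lexx.
  case fp : (f p) => [[j x]|k]; case fq : (f q) => [[h y]|l] /=; rewrite ?ltnn //.
  - move=> jh; have {}jh : (j < h)%N by lia.
    by rewrite jh andbT; apply/eqP => -[e]; rewrite e ltnn in jh.
  - by move=> ji; have := i0le _ _ fq; lia.
  - by lia.
pose Qi := subposet_on (fun x => r x == i).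
have wQi : (width Qi <= 2)%N by apply: leq_trans (width_sub (f := (val : Qi -> Q)) _) wQ.
have rQi (q : Qi) : rk (f (val q)) = i by rewrite -rE; congr nat_of_ord; apply/eqP/(valP q).
have [ii0|ii0] := ltnP i i0.
  have fi (q : Qi) : exists x, f (val q) = inl (inord i, x).
    have := rQi q; case: (f _) => [[j x]|k] /= jE; last by lia.
    by exists x; congr (inl (_, _)); apply: val_inj; rewrite /= inordK; have := ltn_ord j; lia.
  have /fin_all_exists[g gP] := fi.
  apply: (tower_sub towV (f := g)) wQi => [q|p q].
    by have := fV (val q); rewrite gP => /andP[].
  by rewrite le_subposet_on -fmono !gP comb_leE /= ltnn eqxx.
apply: series_ladder_base.
pose isl (q : Qi) := if f (val q) is inl _ then true else false.
exists [set q | isl q]%SET, [set q | ~~ isl q]%SET; split.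
- by apply/setP => q; rewrite !inE orbN.
- by apply/pred0P => q; rewrite /= !inE andbN.
- apply/chainP => p q; rewrite !inE /isl.
  case fp : (f (val p)) => [[j x]|//] _; case fq : (f (val q)) => [[h y]|//] _.
  have := rQi p; have := rQi q; rewrite fp fq /= => hi ji.
  have i0M2 : (i0 < M.+2)%N by have := ltn_ord j; lia.
  have [q0 [k [fq0 ki]]] := i0ex i0M2.
  apply: contraT => pq.
  have := leq_trans (@width_leT _ Q [set val p; val q; q0]%SET (subsetT _) _) wQ.
  have pq0 : val p >< q0.
    by rewrite /Order.comparable -!fmono fp fq0 !comb_leE /=; lia.
  have qq0 : val q >< q0.
    by rewrite /Order.comparable -!fmono fq fq0 !comb_leE /=; lia.
  have pq' : val p >< val q by [].
  have neq (a b : Q) : a >< b -> a != b by apply: contraNneq => ->; rewrite comparablexx.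
  rewrite -setUA cardsU1 cards2 !inE negb_or !neq // => wle.
  suff : false by []; apply: wle.
  apply/antichainP => a b /setU1P[->|/set2P[->|->]] /setU1P[->|/set2P[->|->]] //;
    rewrite 1?(negbTE pq0, negbTE qq0, negbTE pq') // comparable_sym;
    by rewrite 1?(negbTE pq0, negbTE qq0, negbTE pq').
- apply/chainP => p q; rewrite !inE /isl.
  case fp : (f (val p)) => [//|k] _; case fq : (f (val q)) => [//|l] _.
  by rewrite /Order.comparable !le_subposet_on -!fmono fp fq !comb_leE /= leq_total.
- move=> p q; rewrite !inE /isl.
  case fp : (f (val p)) => [[j x]|//] _; case fq : (f (val q)) => [//|l] _ pq.
  rewrite lt_neqAle; apply/andP; split.
    by apply/eqP => e; rewrite e fq in fp.
  by move: pq; rewrite /Order.comparable !le_subposet_on -!fmono fp fq !comb_leE /= orbF.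
Qed.

End TowerStep.

(** An element of [A_i], [i <= M], sharing the colour [M - k] of [d_k] has [i < k], so it is below
    [d_k]. The witnesses for [d_k] are in [A_k]. In the last block, colours up to [M] are witnessed
    by the chain and higher ones by the block. A maximum antichain of that block together with [d_0]
    has [w + 1] elements. *)
Lemma tower_step (w M : nat) (d : Order.disp_t) (T : finPOrderType d) (V : pred T)
    (col : T -> nat) :
  tower w M V col ->
  tower w.+1 (2 * M + 1) (@comb_mem M d T V col) (@comb_col M d T col).
Proof.
move=> towV; have colM := tower_col towV; split.
- move=> [[i x]|k] /=; last by lia.
  by case/andP=> /colM; case: eqP => _ /= xM; lia.
- move=> c cM; have [cM'|cM'] := leqP c M.
    have kM : (M - c < M.+1)%N by lia.
    by exists (inr (Ordinal kM)) => //=; lia.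
  have [|x xV xc] := tower_ne towV (c := c - M.+1); first by lia.
  by exists (inl (ord_max, x)); rewrite /= ?xV eqxx // xc; lia.
- move=> [[i x]|k] [[j y]|l] /=; rewrite comb_comparable /=.
  + case/andP=> xV xi /andP[yV yj].
    have [//|//|/val_inj ij] := ltngtP i j; rewrite ?orbT // -ij eqxx /=.
    have xMx := colM _ xV; have yMy := colM _ yV.
    by case: eqP => _ e; apply: (tower_chain towV) => //; lia.
  + case/andP=> /colM xM xi _; move: xi; have := ltn_ord i; have := ltn_ord l.
    by case: eqP => _ /= *; rewrite orbF; lia.
  + move=> _ /andP[/colM yM yj]; move: yj; have := ltn_ord j; have := ltn_ord k.
    by case: eqP => _ /= *; lia.
  + by rewrite leq_total.
- move=> [[i x]|k] c /=.
  + case/andP=> xV; case: eqP => iM /= xi cx.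
      have [cM|cM] := leqP c M.
        have kM : (M - c < M.+1)%N by lia.
        exists (inr (Ordinal kM)); rewrite comb_comparable /= iM; split=> //; lia.
      have [|y [yV yc xy]] := tower_wit towV (c := c - M.+1) xV; first by lia.
      exists (inl (i, y)); rewrite comb_comparable /= iM !eqxx yV ltnn /=; split=> //.
      by lia.
    have [y [yV yc xy]] := tower_wit towV xV cx.
    exists (inl (i, y)); rewrite comb_comparable /= !eqxx yV ltnn /=; split=> //.
      by rewrite yc (ltn_trans cx) ?orbT.
    by case: eqP.
  + move=> _ cMk; have [|y yV yc] := tower_ne towV (c := c); first by lia.
    have kM2 : (k < M.+2)%N by have := ltn_ord k; lia.
    have kM := ltn_ord k.
    exists (inl (Ordinal kM2, y)); rewrite comb_comparable /= yV ltnn yc.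
    by split=> //; [rewrite cMk orbT|case: eqP => //; lia].
- exact: (comb_width towV).
- have [A [AV acA Aw]] := tower_antichain towV.
  exists ((inr ord0 : comb T M) |: [set (inl (ord_max, x) : comb T M) | x in A])%SET; split.
  + by move=> u /setU1P[->|/imsetP[x xA ->]] //=; rewrite AV // eqxx.
  + move/antichainP: acA => acA.
    apply/antichainP => u v /setU1P[->|/imsetP[x xA ->]] /setU1P[->|/imsetP[y yA ->]] //.
    rewrite comb_comparable /= eqxx ltnn /= => xy; congr (inl (_, _)); exact: acA.
  + rewrite cardsU1 card_imset ?Aw; last by move=> x y [].
    by case: imsetP => // -[x _].
- exact: (comb_sub towV).
Qed.

Lemma tower_exists (w : nat) : (0 < w)%N ->
  exists (d : Order.disp_t) (T : finPOrderType d) (V : pred T) (col : T -> nat),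
    tower w (2 ^ w - 1) V col.
Proof.
elim: w => [//|[|w] IH] _.
  by exists _, 'I_1, predT, (fun=> 0); exact: tower1.
have [//|d [T [V [col tow]]]] := IH; exists d, (comb T (2 ^ w.+1 - 1)).
exists (comb_mem V col), (@comb_col _ d T col).
have := tower_step tow.
have -> : (2 * (2 ^ w.+1 - 1) + 1 = 2 ^ w.+2 - 1)%N.
  by rewrite [(2 ^ w.+2)%N]expnS; have : (0 < 2 ^ w.+1)%N by [rewrite expn_gt0]; lia.
exact.
Qed.

(** The default [set0] lets the same formula cover the opening of a new chain, at [j = size Cs]. *)
Lemma ff_insert_nth (d : Order.disp_t) (P : finPOrderType d) (Cs : seq {set P}) (x : P) j :
    (j <= size Cs)%N ->
    (forall i, (i < j)%N -> ~~ is_chain (x |: nth set0 Cs i)%SET) ->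
    is_chain (x |: nth set0 Cs j)%SET ->
  ff_insert Cs x = set_nth set0 Cs j (x |: nth set0 Cs j)%SET.
Proof.
elim: Cs j => [|C Cs IH] [|j] //=.
- by rewrite setU0.
- by move=> _ _ ->.
move=> jCs nch ch; rewrite (negbTE (nch 0 _)) //; congr (_ :: _).
by apply: IH => // i ij; apply: (nch i.+1).
Qed.

Lemma first_fit_rcons (d : Order.disp_t) (P : finPOrderType d) (s : seq P) x :
  first_fit (rcons s x) = ff_insert (first_fit s) x.
Proof. by rewrite /first_fit -cats1 foldl_cat. Qed.

(* Presented by increasing colour, every element goes to the chain of its
   colour. *)
Lemma first_fit_sorted (d : Order.disp_t) (P : finPOrderType d) (col : P -> nat) (s : seq P) :
    (forall x y, col x = col y -> x >=< y) ->
    (forall x c, (c < col x)%N -> exists2 y, col y = c & x >< y) ->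
    uniq s ->
    pairwise (fun x y => (col x <= col y)%N) s ->
    (forall x y, x \in s -> (col y < col x)%N -> y \in s) ->
  (forall x, x \in s -> x \in nth set0 (first_fit s) (col x)) /\
  (forall i x, x \in nth set0 (first_fit s) i -> col x = i).
Proof.
move=> colP wit; elim/last_ind: s => [|s x IH].
  by move=> *; split=> // i x; rewrite nth_nil inE.
rewrite rcons_uniq pairwise_rcons => /andP[xs us] /andP[/allP sx pws] closed.
have [|mem1 mem2] := IH us pws.
  move=> z y zs yz; have := closed z y; rewrite !mem_rcons !inE zs orbT.
  by move=> /(_ isT yz) /orP[/eqP yx|//]; have := sx _ zs; rewrite -yx leqNgt yz.
rewrite first_fit_rcons; set Cs := first_fit s in mem1 mem2 *.
have lower y : (col y < col x)%N -> y \in s.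
  move=> yx; have := closed x y; rewrite !mem_rcons !inE eqxx => /(_ isT yx).
  by case/orP=> [/eqP yx'|//]; rewrite yx' ltnn in yx.
have nonch i : (i < col x)%N -> exists2 y, y \in nth set0 Cs i & x >< y.
  move=> ix; have [y yi xy] := wit x i ix; exists y => //.
  by rewrite -yi; apply/mem1/lower; rewrite yi.
(* Otherwise [x] would have a witness in the position [size Cs], where [nth] returns the empty
   set. *)
have jCs : (col x <= size Cs)%N.
  rewrite leqNgt; apply/negP => lt; have [y + _] := nonch _ lt.
  by rewrite nth_default // inE.
rewrite (ff_insert_nth (j := col x)) //; last 2 first.
- move=> i /nonch[y yi xy]; apply/negP => /chainP/(_ x y).
  by rewrite !inE eqxx yi orbT => /(_ isT isT); apply/negP.
- apply/chainP => y z yP zP; apply: colP.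
  have cx u : u \in (x |: nth set0 Cs (col x))%SET -> col u = col x.
    by case/setU1P=> [->//|]; apply: mem2.
  by rewrite (cx y) // (cx z).
split=> [y|i y]; rewrite nth_set_nth /=.
- rewrite mem_rcons inE; case: (y =P x) => [-> _|yx]; first by rewrite eqxx !inE eqxx.
  by move=> /= /mem1 ys; case: (col y =P col x) => // e; rewrite !inE -e ys orbT.
- case: eqP => [->|_]; last exact: mem2.
  by case/setU1P=> [->//|]; apply: mem2.
Qed.

(** A tower is presented by increasing colour, and each of its [2 ^ w - 1] colours then has its own
    chain. *)
Lemma first_fit_ge (d : Order.disp_t) (Q : finPOrderType d) (w : nat) :
  (width Q <= 2)%N -> ~ series_ladder Q -> (0 < w)%N ->
  exists (d' : Order.disp_t) (P : finPOrderType d') (s : seq P),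
    [/\ width P = w, poset_free Q P, perm_eq s (enum P) &
      (2 ^ w - 1 <= size (first_fit s))%N].
Proof.
move=> wQ nQ w0; have [d1 [T [V [col tow]]]] := tower_exists w0.
pose P : finPOrderType d1 := subposet_on V.
pose c (x : P) := col (val x).
pose s := sort (fun x y : P => (c x <= c y)%N) (enum P).
have sP x : x \in s by rewrite mem_sort mem_enum.
exists d1, P, s; split.
- apply/eqP; rewrite eqn_leq; apply/andP; split.
    apply/bigmax_leqP => A /antichainP acA.
    rewrite -(card_imset _ val_inj); apply: (tower_width tow).
      by move=> _ /imsetP[x _ ->]; apply: valP.
    apply/antichainP => _ _ /imsetP[x xA ->] /imsetP[y yA ->] xy.
    by congr val; apply: acA.
  have [A [AV acA <-]] := tower_antichain tow.
  pose B := [set x : P | val x \in A]%SET.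
  have -> : A = [set val x | x in B]%SET.
    apply/setP => x; apply/idP/imsetP => [xA|[y + ->]]; last by rewrite inE.
    by exists (exist _ x (AV _ xA)); rewrite ?inE.
  rewrite (card_imset _ val_inj); apply: width_leT; first exact: subsetT.
  move/antichainP: acA => acA; apply/antichainP => x y; rewrite !inE => xA yA xy.
  by apply: val_inj; apply: acA.
- case=> f fmono; apply: nQ; apply: (tower_sub tow (f := fun q => val (f q))) => //.
  by move=> q; apply: valP.
- by rewrite perm_sort.
- have [|||||mem1 _] := @first_fit_sorted _ P c s.
  + by move=> x y xy; apply: (tower_chain tow) => //; apply: valP.
  + move=> x i ix; have [y [yV yi xy]] := tower_wit tow (valP x) ix.
    by exists (exist _ y yV).
  + by rewrite sort_uniq enum_uniq.
  + rewrite -sorted_pairwise; first by apply: sort_sorted => x y; apply: leq_total.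
    by move=> x y z; apply: leq_trans.
  + by move=> *; apply: sP.
  rewrite leqNgt; apply/negP => lt.
  have [x xV xc] := tower_ne tow lt.
  by have := mem1 (exist _ x xV : P) (sP _); rewrite /c /= xc nth_default // inE.
Qed.

Local Open Scope ring_scope.

Lemma trunc_log_le_lg (R : realType) (w : nat) : (0 < w)%N ->
  (trunc_log 2 w)%:R <= lg (w%:R : R).
Proof.
move=> w0; have ln2 : 0 < ln (2 : R) by apply: ln_gt0; rewrite ltr1n.
rewrite /lg ler_pdivlMr // mulr_natl -lnXn ?ltr0n // ler_ln ?posrE ?exprn_gt0 ?ltr0n //.
by rewrite -natrX ler_nat trunc_logP.
Qed.

Theorem theorem8 (R : realType) :
  exists K : R,
    forall (n : nat) (d : Order.disp_t) (Q : finPOrderType d),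
      #|Q| = n -> width Q = 2%N ->
      (series_ladder Q ->
         exists2 C : R, C <= K * n%:R &
           forall w : nat, (0 < w)%N ->
             (FF R w Q <= (2 `^ (C * lg (w%:R : R) ^+ 2))%:E)%E) /\
      (~ series_ladder Q ->
         forall w : nat, (0 < w)%N -> ((2 ^+ w - 1)%:E <= FF R w Q)%E).
Proof.
(* The constant is [11 * 2 ^ 2]: the exponent [11 * l ^ 2 * #|Q|] is used with
   [l = trunc_log 2 w + 1], which is at most [2 * lg w] once [w >= 2]. *)
exists 44%:R => n d Q <- wQ; split=> [slQ|nslQ w w0]; last first.
  have wQ2 : (width Q <= 2)%N by rewrite wQ.
  have [d' [P [s [wP freeP sP sizeP]]]] := first_fit_ge wQ2 nslQ w0.
  apply: le_trans (ereal_sup_ubound _); last first.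
    by exists (size (first_fit s)) => //; right; exists d', P, s.
  by rewrite lee_fin lerBlDr -natrX -(natrD _ _ 1) ler_nat; lia.
exists (44%:R * #|Q|%:R) => // w w0.
apply: ge_ereal_sup => _ [k [->|[d' [P [s [wP freeP sP ->]]]]] <-]; rewrite lee_fin.
  exact: powR_ge0.
have {}sP x : x \in s by rewrite (perm_mem sP) mem_enum.
have [w1|w1] := leqP w 1.
  have {w1 w0}w1 : w = 1%N by lia.
  rewrite w1 /lg ln1 mul0r expr0n mulr0 powRr0 (ler_nat _ _ 1).
  by apply: width1_first_fit; rewrite ?wP.
set t := trunc_log 2 w; have t0 : (0 < t)%N by rewrite trunc_log_gt0.
have wl : (width P < 2 ^ t.+1)%N by rewrite wP trunc_log_ltn.
have wP0 : (0 < width P)%N by rewrite wP.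
have := first_fit_le slQ freeP sP wP0 (ltn0Sn t) wl.
rewrite -(ler_nat R) => /le_trans; apply; rewrite natrX -[X in X <= _]powR_mulrn //.
apply: ler_powR; first by rewrite ler1n.
have tlg : t.+1%:R <= 2 * lg (w%:R : R).
  apply: le_trans (_ : 2 * t%:R <= _); first by rewrite -natrM ler_nat; lia.
  by rewrite ler_pM2l // trunc_log_le_lg.
have -> : 44%:R * #|Q|%:R * lg (w%:R : R) ^+ 2 =
    11%:R * (2 * lg (w%:R : R)) ^+ 2 * #|Q|%:R.
  by ring.
rewrite natrM (natrM _ 11) natrX ler_wpM2r // ler_wpM2l // lerXn2r // nnegrE //.
exact: le_trans tlg.
Qed.
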